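(* Let $M$ be a finitely generated torsion $R$-module and let $n \geq 0$. For an exact sequence \[ 0 \to N \to P_1 \to \dots \to P_n \to M \to 0 \qquad (\ast) \] of finitely generated torsion $R$-modules with $\mathrm{pd}_R(P_i) \leq 1$ for $1 \leq i \leq n$, consider the fractional ideal \[ \mathcal{F}^{[n]}(M) = \left(\prod_{i=1}^n \mathrm{Fitt}_R(P_i)^{(-1)^i}\right) \mathrm{Fitt}_R(N) \] of $R$. Then $\mathcal{F}^{[n]}(M)$ is independent of the choice of the sequence $(\ast)$.
   Context: Let $p$ be an odd prime, $K$ a totally real number field, $K^{\mathrm{cyc}}$ its cyclotomic $\mathbb{Z}_p$-extension, $K'$ a totally real finite abelian $p$-extension of $K$ with $K' \cap K^{\mathrm{cyc}} = K$, $L = K'K^{\mathrm{cyc}}$, $G = \mathrm{Gal}(L/K)$, $\Delta = \mathrm{Gal}(L/K^{\mathrm{cyc}})$ (a finite abelian $p$-group), so that $G = \mathrm{Gal}(L/K') \times \Delta$ with $\mathrm{Gal}(L/K') \simeq \mathbb{Z}_p$. Put $R = \mathbb{Z}_p[[G]]$; choosing a topological generator $\gamma$ of $\mathrm{Gal}(L/K')$ gives $R \simeq \mathbb{Z}_p[[T]][\Delta]$, $\gamma \mapsto 1+T$. An $R$-module is called torsion if it is torsion as a $\mathbb{Z}_p[[T]]$-module. $\mathrm{pd}_R$ denotes projective dimension over $R$. $\mathrm{Fitt}_R(M)$ is the (initial) Fitting ideal: for a presentation $R^b \xrightarrow{h} R^a \to M \to 0$ with $h$ viewed as an $a\times b$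 matrix, it is the ideal generated by all $a \times a$ minors of $h$. Fractional ideals of $R$ are finitely generated $R$-submodules of the total ring of fractions $Q(R)$ of $R$. For a finitely generated torsion $R$-module $P$ with $\mathrm{pd}_R(P)\le 1$, the ideal $\mathrm{Fitt}_R(P)$ is invertible as a fractional ideal, so its negative powers make sense. *)

(* Defs.v *)
From HB Require Import structures.
From mathcomp Require Import all_boot all_order all_algebra all_field.
From mathcomp Require Import boolp classical_sets.
Set Implicit Arguments.
Unset Strict Implicit.
Unset Printing Implicit Defensive.
Import GRing.Theory.
Local Open Scope ring_scope.
Local Open Scope classical_set_scope.

(** * The ring of p-adic integers *)

(* Z_p is the inverse limit of the rings Z/p^(n+1), n >= 0; the component of
   index n is the residue modulo p^(n+1).  (The shift avoids the component
   Z/p^0, since 'Z_1 denotes Z/2 in the library.) *)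
Record Zp_int (p : nat) := ZpInt {
  zres : forall n : nat, 'Z_(p ^ n.+1);
  zres_compat : forall n, (zres n.+1 : nat)%:R = zres n
}.

Section PadicIntegers.
Variable p : nat.
Implicit Types a b c : Zp_int p.

HB.instance Definition _ := gen_eqMixin (Zp_int p).
HB.instance Definition _ := gen_choiceMixin (Zp_int p).

Lemma Zp_int_eq a b : (forall n, zres a n = zres b n) -> a = b.
Proof.
case: a b => [a Ha] [b Hb] /= H.
have E : a = b by apply: functional_extensionality_dep.
by subst b; congr ZpInt; apply: Prop_irrelevance.
Qed.

Lemma Zp_trunc_dvd n : ((Zp_trunc (p ^ n.+1)).+2 %| (Zp_trunc (p ^ n.+2)).+2)%N.
Proof.
case: (ltnP 1 p) => [p1|].
  rewrite !Zp_cast; first by rewrite [(p ^ n.+2)%N]expnS dvdn_mull.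
    by rewrite (leq_trans p1) // -{1}(expn1 p) leq_exp2l.
  by rewrite (leq_trans p1) // -{1}(expn1 p) leq_exp2l.
by case: p => [|[|//]] _; rewrite ?exp0n ?exp1n.
Qed.

Lemma natr_Zp_mod m n : (m %% (Zp_trunc (p ^ n.+2)).+2)%N%:R = m%:R :> 'Z_(p ^ n.+1).
Proof.
rewrite !Zp_nat; apply: val_inj; rewrite /=.
by rewrite modn_dvdm // Zp_trunc_dvd.
Qed.

Lemma Zp0_subproof n : (nat_of_ord (0%R : 'Z_(p ^ n.+2)))%:R = 0 :> 'Z_(p ^ n.+1).
Proof. by []. Qed.

Lemma Zp1_subproof n : (nat_of_ord (1%R : 'Z_(p ^ n.+2)))%:R = 1 :> 'Z_(p ^ n.+1).
Proof. by []. Qed.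

Definition Zp_zero := ZpInt Zp0_subproof.
Definition Zp_one := ZpInt Zp1_subproof.

Lemma Zp_add_subproof a b n :
  (nat_of_ord (zres a n.+1 + zres b n.+1)%R)%:R = zres a n + zres b n.
Proof. by rewrite /= natr_Zp_mod natrD !zres_compat. Qed.

Lemma Zp_mul_subproof a b n :
  (nat_of_ord (zres a n.+1 * zres b n.+1)%R)%:R = zres a n * zres b n.
Proof. by rewrite /= natr_Zp_mod natrM !zres_compat. Qed.

Lemma Zp_opp_subproof a n :
  (nat_of_ord (- zres a n.+1)%R)%:R = - zres a n.
Proof.
apply/eqP; rewrite -subr_eq0 opprK -(zres_compat a n) -natrD -natr_Zp_mod.
by apply/eqP; rewrite -[RHS]Zp0_subproof -(addNr (zres a n.+1)).
Qed.

Definition Zp_add a b := ZpInt (Zp_add_subproof a b).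
Definition Zp_mul a b := ZpInt (Zp_mul_subproof a b).
Definition Zp_opp a := ZpInt (Zp_opp_subproof a).

Lemma Zp_addA : associative Zp_add.
Proof. by move=> a b c; apply: Zp_int_eq => n /=; rewrite addrA. Qed.
Lemma Zp_addC : commutative Zp_add.
Proof. by move=> a b; apply: Zp_int_eq => n /=; rewrite addrC. Qed.
Lemma Zp_add0 : left_id Zp_zero Zp_add.
Proof. by move=> a; apply: Zp_int_eq => n /=; rewrite add0r. Qed.
Lemma Zp_addN : left_inverse Zp_zero Zp_opp Zp_add.
Proof. by move=> a; apply: Zp_int_eq => n /=; rewrite addNr. Qed.

HB.instance Definition _ :=
  GRing.isZmodule.Build (Zp_int p) Zp_addA Zp_addC Zp_add0 Zp_addN.

Lemma Zp_mulA : associative Zp_mul.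
Proof. by move=> a b c; apply: Zp_int_eq => n /=; rewrite mulrA. Qed.
Lemma Zp_mulC : commutative Zp_mul.
Proof. by move=> a b; apply: Zp_int_eq => n /=; rewrite mulrC. Qed.
Lemma Zp_mul1 : left_id Zp_one Zp_mul.
Proof. by move=> a; apply: Zp_int_eq => n /=; rewrite mul1r. Qed.
Lemma Zp_mulDl : left_distributive Zp_mul Zp_add.
Proof. by move=> a b c; apply: Zp_int_eq => n /=; rewrite mulrDl. Qed.
Lemma Zp_one_neq0 : Zp_one != Zp_zero.
Proof. by apply/eqP => /(congr1 (fun a => zres a 0)). Qed.

HB.instance Definition _ := GRing.Zmodule_isComNzRing.Build (Zp_int p)
  Zp_mulA Zp_mulC Zp_mul1 Zp_mulDl Zp_one_neq0.

End PadicIntegers.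

(** * Subfields of the field of algebraic numbers and their automorphisms *)

(* All the fields under consideration are subfields of algC, a fixed algebraic
   closure of the field of rational numbers. *)
Definition is_subfield (F : set algC) : Prop :=
  F 1 /\ (forall x y, F x -> F y -> F (x - y)) /\
  (forall x y, F x -> F y -> F (x / y)).

Definition generated_field (S : set algC) : set algC :=
  [set x | forall F, is_subfield F -> S `<=` F -> F x].

Definition compositum (E F : set algC) : set algC := generated_field (E `|` F).

Definition finite_extension (K F : set algC) : Prop :=
  K `<=` F /\ exists s : seq algC, (forall x, x \in s -> F x) /\
    forall x, F x -> exists c : 'I_(size s) -> algC,
      (forall i, K (c i)) /\ x = \sum_i c i * s`_i.

Definition is_number_field (F : set algC) : Prop :=
  is_subfield F /\ finite_extension [set x | x \in Crat] F.

(* sigma : algC -> algC restricts to a ring morphism F -> algC; its values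
   outside of F are irrelevant. *)
Definition is_embedding (F : set algC) (sigma : algC -> algC) : Prop :=
  sigma 1 = 1 /\
  (forall x y, F x -> F y -> sigma (x + y) = sigma x + sigma y) /\
  (forall x y, F x -> F y -> sigma (x * y) = sigma x * sigma y).

Definition is_totally_real (F : set algC) : Prop :=
  forall sigma, is_embedding F sigma -> forall x, F x -> sigma x \in Num.real.

Definition is_automorphism (K F : set algC) (sigma : algC -> algC) : Prop :=
  is_embedding F sigma /\ (forall x, K x -> sigma x = x) /\ sigma @` F = F.

(* As F is a subfield of algC, F is algebraic and separable over K. *)
Definition is_Galois (K F : set algC) : Prop :=
  K `<=` F /\
  forall x, F x -> (forall sigma, is_automorphism K F sigma -> sigma x = x) -> K x.

(* The group G, together with act : G -> algC -> algC, is the group of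
   automorphisms of F over K (which acts faithfully on F).  Only abelian Galois
   groups occur below, and they are written additively. *)
Definition is_Galois_group (K F : set algC) (G : zmodType)
    (act : G -> algC -> algC) : Prop :=
  (forall g, is_automorphism K F (act g)) /\
  (forall g h x, F x -> act (g + h) x = act g (act h x)) /\
  (forall g h, (forall x, F x -> act g x = act h x) -> g = h) /\
  (forall sigma, is_automorphism K F sigma ->
     exists g, forall x, F x -> act g x = sigma x).

Definition is_subgroup (G : zmodType) (U : set G) : Prop :=
  U 0 /\ forall g h, U g -> U h -> U (g - h).

Definition fixing (G : zmodType) (act : G -> algC -> algC) (E : set algC) : set G :=
  [set g | forall x, E x -> act g x = x].

(* Open subgroups of a Galois group of F, for the Krull topology. *)
Definition Krull_open (F : set algC) (G : zmodType) (act : G -> algC -> algC)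
    (U : set G) : Prop :=
  is_subgroup U /\
  exists s : seq algC, (forall x, x \in s -> F x) /\
    fixing act [set x | x \in s] `<=` U.

(* u : Z_p -> G is an isomorphism of topological groups from Z_p onto the
   subgroup H of G (with the topology induced by the Krull topology). *)
Definition Zp_isomorphism (p : nat) (F : set algC) (G : zmodType)
    (act : G -> algC -> algC) (H : set G) (u : Zp_int p -> G) : Prop :=
  (forall a b, u (a + b) = u a + u b) /\ injective u /\ range u = H /\
  (forall U, Krull_open F act U -> exists n, forall a, U (u (a *+ p ^ n))) /\
  (forall n, exists2 U, Krull_open F act U &
     forall a, U (u a) -> exists b, a = b *+ p ^ n).

Definition is_Zp_extension (p : nat) (K F : set algC) : Prop :=
  is_Galois K F /\
  exists (G : zmodType) (act : G -> algC -> algC) (u : Zp_int p -> G),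
    is_Galois_group K F act /\ Zp_isomorphism F act setT u.

Definition p_power_roots_of_unity (p : nat) : set algC :=
  [set z | exists n, z ^+ (p ^ n) = 1].

(* The cyclotomic Z_p-extension of K is the unique Z_p-extension of K which is
   contained in the field K(mu_(p^oo)). *)
Definition is_cyclotomic_Zp_extension (p : nat) (K F : set algC) : Prop :=
  is_subfield F /\ F `<=` generated_field (K `|` p_power_roots_of_unity p) /\
  is_Zp_extension p K F.

Definition is_abelian_p_extension (p : nat) (K F : set algC) : Prop :=
  finite_extension K F /\ is_Galois K F /\
  exists (D : finZmodType) (act : D -> algC -> algC),
    is_Galois_group K F act /\ p.-nat #|D|.

(* H is isomorphic to Z_p and gamma is a topological generator of H. *)
Definition is_Zp_generator (p : nat) (F : set algC) (G : zmodType)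
    (act : G -> algC -> algC) (H : set G) (gamma : G) : Prop :=
  exists u : Zp_int p -> G, Zp_isomorphism F act H u /\ u 1 = gamma.

(** * The completed group ring Z_p[[G]] *)

Section FiniteIndex.
Variable G : zmodType.
Implicit Types (U V : set G) (g h : G).

Definition finite_index U : Prop :=
  exists s : seq G, forall g, exists2 h, h \in s & U (g - h).

Definition coset_repr U g : G := xget 0 [set h | U (g - h)].

Definition transversal U : seq G :=
  if pselect (finite_index U) is left fi
  then undup [seq coset_repr U h | h <- projT1 (cid fi)] else [::].

Section Lemmas.
Variable U : set G.
Hypothesis sU : is_subgroup U.
Hypothesis fU : finite_index U.

Lemma sub0g : U 0. Proof. by case: sU. Qed.
Lemma subBg g h : U g -> U h -> U (g - h). Proof. by case: sU => _; apply. Qed.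
Lemma subNg g : U g -> U (- g).
Proof. by move=> Ug; rewrite -sub0r; apply: subBg => //; exact: sub0g. Qed.
Lemma subDg g h : U g -> U h -> U (g + h).
Proof. by move=> Ug Uh; rewrite -(opprK h); apply: subBg => //; exact: subNg. Qed.
Lemma subBC g h : U (g - h) -> U (h - g).
Proof. by move=> /subNg; rewrite opprB. Qed.
Lemma sub_trans g h k : U (g - h) -> U (h - k) -> U (g - k).
Proof. by move=> /subDg/[apply]; rewrite addrA subrK. Qed.

Lemma coset_reprP g : U (g - coset_repr U g).
Proof. by rewrite /coset_repr; case: xgetP => [y -> //|/(_ g)]; rewrite /= subrr; have := sub0g. Qed.

Lemma coset_repr_eq g h : U (g - h) -> coset_repr U g = coset_repr U h.
Proof.
move=> Ugh; rewrite /coset_repr; congr xget.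
apply/seteqP; split=> k /= Hk; first by apply: (sub_trans (subBC Ugh) Hk).
exact: (sub_trans Ugh Hk).
Qed.

Lemma coset_repr_id g : coset_repr U (coset_repr U g) = coset_repr U g.
Proof. by apply/esym/coset_repr_eq; exact: coset_reprP. Qed.

Lemma mem_transversal g : (g \in transversal U) = (coset_repr U g == g).
Proof.
rewrite /transversal; case: pselect => [fi|//]; rewrite mem_undup.
apply/mapP/eqP => [[h _ ->]|<-]; first exact: coset_repr_id.
case: (projT2 (cid fi) g) => h hs Ugh; exists h => //; exact: coset_repr_eq.
Qed.

Lemma uniq_transversal : uniq (transversal U).
Proof. by rewrite /transversal; case: pselect => // fi; exact: undup_uniq. Qed.

Section Sums.
Variable A : zmodType.
Implicit Types F : G -> A.

Lemma coset_sum_reindex (f f' : G -> G) F :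
    (forall g h, U h -> F (g + h) = F g) ->
    (forall g h, U (g - h) -> U (f g - f h)) ->
    (forall g h, U (g - h) -> U (f' g - f' h)) ->
    cancel f f' -> cancel f' f ->
  \sum_(h <- transversal U) F (f h) = \sum_(h <- transversal U) F h.
Proof.
move=> FU fU1 fU2 fK fK'.
have Frep g : F (coset_repr U g) = F g.
  have /subNg H := coset_reprP g.
  by rewrite -(FU g _ H) opprB addrC subrK.
transitivity (\sum_(h <- [seq coset_repr U (f h) | h <- transversal U]) F h).
  by rewrite big_map; apply: eq_bigr => h _; rewrite Frep.
apply/perm_big/uniq_perm; last 1 first.
- move=> g; rewrite mem_transversal; apply/mapP/eqP => [[h _ ->]|E].
    exact: coset_repr_id.
  exists (coset_repr U (f' g)); first by rewrite mem_transversal coset_repr_id.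
  rewrite -{1}E -{1}(fK' g); apply: coset_repr_eq; apply: fU1; exact: coset_reprP.
- rewrite map_inj_in_uniq ?uniq_transversal // => g h.
  rewrite !mem_transversal => /eqP Eg /eqP Eh E.
  rewrite -Eg -Eh; apply: coset_repr_eq; rewrite -(fK g) -(fK h); apply: fU2.
  apply: (sub_trans (coset_reprP (f g))); rewrite E.
  by apply: subBC; exact: coset_reprP.
- exact: uniq_transversal.
Qed.

Lemma coset_sum_shift k F : (forall g h, U h -> F (g + h) = F g) ->
  \sum_(h <- transversal U) F (h - k) = \sum_(h <- transversal U) F h.
Proof.
move=> FU; apply: (@coset_sum_reindex _ (fun h => h + k)) => //.
- by move=> g h; rewrite opprB addrA subrK.
- by move=> g h; rewrite opprD [X in _ -> U X]addrACA subrr addr0.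
- by move=> g; rewrite subrK.
- by move=> g; rewrite addrK.
Qed.

Lemma coset_sum_flip k F : (forall g h, U h -> F (g + h) = F g) ->
  \sum_(h <- transversal U) F (k - h) = \sum_(h <- transversal U) F h.
Proof.
move=> FU; apply: (@coset_sum_reindex _ (fun h => k - h)) => //.
- by move=> g h /subBC Ugh; rewrite opprB addrC addrA subrK.
- by move=> g h /subBC Ugh; rewrite opprB addrC addrA subrK.
- by move=> g; rewrite subKr.
- by move=> g; rewrite subKr.
Qed.

Lemma coset_sum_delta g F : (forall g h, U h -> F (g + h) = F g) ->
  \sum_(h <- transversal U | `[< U (g - h) >]) F h = F g.
Proof.
move=> FU.
have Frep : F (coset_repr U g) = F g.
  have /subNg H := coset_reprP g.
  by rewrite -(FU g _ H) opprB addrC subrK.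
have rT : coset_repr U g \in transversal U by rewrite mem_transversal coset_repr_id.
rewrite -big_filter -Frep -[RHS](big_seq1 +%R _ F).
apply/perm_big/uniq_perm => //; first by rewrite filter_uniq ?uniq_transversal.
move=> h; rewrite mem_filter inE mem_transversal.
apply/andP/eqP => [[/asboolP Ugh /eqP <-]|->].
  by apply/esym/coset_repr_eq.
split; first by apply/asboolP; exact: coset_reprP.
by rewrite coset_repr_id.
Qed.

End Sums.
End Lemmas.
End FiniteIndex.

Section CompletedGroupRing.
Variables (p : nat) (F : set algC) (G : zmodType) (act : G -> algC -> algC).

(* In a Galois group, which is profinite, the finiteness of the index is
   automatic for an open subgroup. *)
Record open_subgroup := OpenSubgroup {
  osub :> set G;
  osub_open : Krull_open F act osub;
  osub_fin : finite_index osub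
}.

(* Z_p[[G]] is the inverse limit of the group rings Z_p[G/U] over the open
   subgroups U.  The coefficient at the class of g of the component of x in
   Z_p[G/U] is cgr_coef x U g (a U-periodic function of g); the transition map
   Z_p[G/U] -> Z_p[G/V], for U included in V, sums coefficients over the classes
   modulo U contained in a given class modulo V. *)
Record completed_group_ring := CompletedGroupRing {
  cgr_coef : open_subgroup -> G -> Zp_int p;
  cgr_periodic : forall (U : open_subgroup) g h,
    osub U h -> cgr_coef U (g + h) = cgr_coef U g;
  cgr_compat : forall U V : open_subgroup, U `<=` V -> forall g,
    cgr_coef V g = \sum_(h <- transversal U | `[< osub V (g - h) >]) cgr_coef U h
}.

Implicit Types (x y z : completed_group_ring) (U V : open_subgroup) (g h k : G).

HB.instance Definition _ := gen_eqMixin completed_group_ring.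
HB.instance Definition _ := gen_choiceMixin completed_group_ring.

Lemma cgr_eq x y : (forall U g, cgr_coef x U g = cgr_coef y U g) -> x = y.
Proof.
case: x y => [x px cx] [y py cy] /= H.
have E : x = y.
  by apply: functional_extensionality_dep => U; apply: functional_extensionality_dep.
by subst y; congr CompletedGroupRing; apply: Prop_irrelevance.
Qed.

Lemma osub_subgroup U : is_subgroup U. Proof. by case: (osub_open U). Qed.
#[local] Hint Resolve osub_subgroup osub_fin : core.

Lemma cgr_periodicB x U k g h : osub U h ->
  cgr_coef x U (k - (g + h)) = cgr_coef x U (k - g).
Proof.
by move=> Uh; rewrite opprD addrA; apply: cgr_periodic; apply: subNg.
Qed.

Lemma asbool_subC U g h : `[< osub U (g - h) >] = `[< osub U (h - g) >].
Proof. by apply: asbool_equiv_eq; split; apply: subBC. Qed.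

Lemma asbool_periodic U V g h k : U `<=` V -> osub U k ->
  `[< osub V (g - (h + k)) >] = `[< osub V (g - h) >].
Proof.
move=> UV /UV Vk; apply: asbool_equiv_eq; rewrite opprD addrA; split => H.
  by rewrite -(subrK k (g - h)); apply: subDg.
by apply: subBg.
Qed.

Definition cgr_zero : completed_group_ring.
Proof.
exists (fun _ _ => 0) => //.
by move=> U V _ g; rewrite big1.
Defined.

Definition cgr_add x y : completed_group_ring.
Proof.
exists (fun U g => cgr_coef x U g + cgr_coef y U g).
  by move=> U g h Uh; rewrite !cgr_periodic.
by move=> U V UV g; rewrite (cgr_compat x UV) (cgr_compat y UV) big_split.
Defined.

Definition cgr_opp x : completed_group_ring.
Proof.
exists (fun U g => - cgr_coef x U g).
  by move=> U g h Uh; rewrite !cgr_periodic.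
by move=> U V UV g; rewrite (cgr_compat x UV) sumrN.
Defined.

Definition group_element (gamma : G) : completed_group_ring.
Proof.
exists (fun U g => if `[< osub U (g - gamma) >] then 1 else 0).
  move=> U g h Uh; congr (if _ then _ else _).
  by rewrite asbool_subC (@asbool_periodic U) // asbool_subC.
move=> U V UV g; rewrite -big_mkcondr.
under eq_bigl => h do rewrite andbC asbool_subC.
rewrite big_mkcondr.
rewrite (@coset_sum_delta _ U _ _ _ gamma
  (fun h => if `[< osub V (g - h) >] then 1 else 0)) //.
by move=> h k Uk; rewrite (asbool_periodic g h UV Uk).
Defined.

Definition cgr_mul x y : completed_group_ring.
Proof.
exists (fun U g => \sum_(h <- transversal U) cgr_coef x U h * cgr_coef y U (g - h)).
  move=> U g h Uh; apply: eq_bigr => k _.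
  by rewrite addrAC (@cgr_periodic y U _ _ Uh).
move=> U V UV g; rewrite [RHS]exchange_big /=.
transitivity (\sum_(k <- transversal U) cgr_coef x U k * cgr_coef y V (g - k)).
  under eq_bigr => k _ do rewrite (cgr_compat x UV) mulr_suml big_mkcond.
  rewrite exchange_big /=; apply: eq_bigr => k _.
  rewrite -big_mkcond /= -mulr_sumr; congr (_ * _).
  under eq_bigl => h do rewrite asbool_subC.
  rewrite (@coset_sum_delta _ V _ _ _ k (fun h => cgr_coef y V (g - h))) //.
  by move=> h l Vl; rewrite cgr_periodicB.
apply: eq_bigr => k _; rewrite -mulr_sumr; congr (_ * _).
apply/esym; rewrite (cgr_compat y UV) [RHS]big_mkcond /=.
rewrite -[RHS](@coset_sum_shift _ U _ _ _ k (fun h =>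
  if `[< osub V (g - k - h) >] then cgr_coef y U h else 0)) //=; last first.
  move=> h l Ul; rewrite (asbool_periodic (g - k) h UV Ul).
  by rewrite (@cgr_periodic y U h l Ul).
rewrite [LHS]big_mkcond; apply: eq_bigr => h _.
by rewrite opprB addrA subrK.
Defined.

Lemma cgr_addA : associative cgr_add.
Proof. by move=> x y z; apply: cgr_eq => U g /=; rewrite addrA. Qed.
Lemma cgr_addC : commutative cgr_add.
Proof. by move=> x y; apply: cgr_eq => U g /=; rewrite addrC. Qed.
Lemma cgr_add0 : left_id cgr_zero cgr_add.
Proof. by move=> x; apply: cgr_eq => U g /=; rewrite add0r. Qed.
Lemma cgr_addN : left_inverse cgr_zero cgr_opp cgr_add.
Proof. by move=> x; apply: cgr_eq => U g /=; rewrite addNr. Qed.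

HB.instance Definition _ :=
  GRing.isZmodule.Build completed_group_ring cgr_addA cgr_addC cgr_add0 cgr_addN.

Lemma cgr_mulC : commutative cgr_mul.
Proof.
move=> x y; apply: cgr_eq => U g /=.
rewrite -(@coset_sum_flip _ U _ _ _ g) //=.
  by apply: eq_bigr => h _; rewrite subKr mulrC.
by move=> h k Uk; rewrite cgr_periodic // cgr_periodicB.
Qed.

Lemma cgr_mulA : associative cgr_mul.
Proof.
move=> x y z; apply: cgr_eq => U g /=; apply/esym.
under eq_bigr => h _ do rewrite mulr_suml.
rewrite exchange_big /=; apply: eq_bigr => k _.
rewrite mulr_sumr.
rewrite -[RHS](@coset_sum_shift _ U _ _ _ k) //=.
  by apply: eq_bigr => h _; rewrite -mulrA opprB addrA subrK.
by move=> h l Ul; rewrite cgr_periodic // cgr_periodicB.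
Qed.

Lemma cgr_mul1 : left_id (group_element 0) cgr_mul.
Proof.
move=> x; apply: cgr_eq => U g /=.
transitivity (\sum_(h <- transversal U | `[< osub U (0 - h) >]) cgr_coef x U (g - h)).
  rewrite [RHS]big_mkcond; apply: eq_bigr => h _.
  by rewrite asbool_subC; case: asboolP => _; rewrite ?mul1r ?mul0r.
rewrite (@coset_sum_delta _ U _ _ _ 0 (fun h => cgr_coef x U (g - h))) ?subr0 //.
by move=> h k Uk; rewrite cgr_periodicB.
Qed.

Lemma cgr_mulDl : left_distributive cgr_mul cgr_add.
Proof.
move=> x y z; apply: cgr_eq => U g /=; rewrite -big_split.
by apply: eq_bigr => h _; rewrite mulrDl.
Qed.

Lemma whole_group_open : Krull_open F act setT.
Proof. by split; [split|exists [::]]. Qed.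

Lemma whole_group_fin : finite_index [set: G].
Proof. by exists [:: 0] => g; exists 0; rewrite ?inE. Qed.

Lemma cgr_one_neq0 : group_element 0 != cgr_zero.
Proof.
apply/eqP => /(congr1 (fun x =>
  cgr_coef x (OpenSubgroup whole_group_open whole_group_fin) 0)) /=.
by case: asboolP => // _ /eqP; rewrite oner_eq0.
Qed.

HB.instance Definition _ := GRing.Zmodule_isComNzRing.Build completed_group_ring
  cgr_mulA cgr_mulC cgr_mul1 cgr_mulDl cgr_one_neq0.

(* The element x of Z_p[[G]] is the sum of the series
     \sum_i f_i (gamma - 1)^i,
   i.e. the image of the power series f under the map Z_p[[T]] -> Z_p[[G]]
   sending T to gamma - 1: in each Z_p[G/U], the coefficients of the partial
   sums converge p-adically to those of x. *)
Definition is_power_series_value (gamma : G) (f : nat -> Zp_int p)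
    (x : completed_group_ring) : Prop :=
  forall (U : open_subgroup) (m : nat), exists N0, forall N, (N0 <= N)%N ->
    forall g, exists b : Zp_int p,
      cgr_coef x U g
      - \sum_(i < N) f i * cgr_coef ((group_element gamma - 1) ^+ i) U g
      = b *+ p ^ m.

(* M is torsion over Z_p[[T]], which acts through T |-> gamma - 1. *)
Definition is_torsion (gamma : G) (M : lmodType completed_group_ring) : Prop :=
  forall v : M, exists (f : nat -> Zp_int p) (x : completed_group_ring),
    (exists i, f i != 0) /\ is_power_series_value gamma f x /\ x *: v = 0.

End CompletedGroupRing.

(** * Modules, projective dimension and Fitting ideals *)

Section Modules.
Variable R : comNzRingType.

Definition surjective (A B : Type) (f : A -> B) : Prop := forall b, exists a, f a = b.

Definition finitely_generated (M : lmodType R) : Prop :=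
  exists (a : nat) (v : 'I_a -> M),
    forall x, exists c : 'I_a -> R, x = \sum_i c i *: v i.

Definition is_projective (P : lmodType R) : Prop :=
  forall (A B : lmodType R) (f : {linear A -> B}) (g : {linear P -> B}),
    surjective f -> exists h : {linear P -> A}, forall x, f (h x) = g x.

(* pd_R(M) <= d: M has a projective resolution of length d. *)
Fixpoint pd_le (d : nat) (M : lmodType R) : Prop :=
  if d is d'.+1 then
    exists (P K : lmodType R) (i : {linear K -> P}) (e : {linear P -> M}),
      is_projective P /\ injective i /\ (forall x, e x = 0 <-> range i x) /\
      surjective e /\ pd_le d' K
  else is_projective M.

(* R^b --h--> R^a --e--> M --> 0 is exact *)
Definition is_presentation (M : lmodType R) (a b : nat) (h : 'M[R]_(a, b))
    (e : {linear 'cV[R]_a -> M}) : Prop :=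
  surjective e /\ forall v, e v = 0 <-> exists w : 'cV[R]_b, v = h *m w.

(* The ideal generated by the a x a minors of h.  Choices of columns with
   repetitions, or in a different order, are harmless: they only contribute the
   value 0, or the opposite of a minor. *)
Definition minors_ideal (a b : nat) (h : 'M[R]_(a, b)) : set R :=
  [set x | exists c : {ffun 'I_a -> 'I_b} -> R, x = \sum_s c s * \det (colsub s h)].

(* This ideal does not depend on the presentation (Fitting's lemma). *)
Definition Fitt (M : lmodType R) : set R :=
  [set x | exists (a b : nat) (h : 'M[R]_(a, b)) (e : {linear 'cV[R]_a -> M}),
     is_presentation h e /\ minors_ideal h x].

(** ** Fractional ideals *)

Section Fractional.
Variables (Q : comUnitRingType) (iota : {rmorphism R -> Q}).

(* Q, together with iota, is the total ring of fractions of R. *)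
Definition is_total_fraction_ring : Prop :=
  injective iota /\
  (forall s : R, GRing.lreg s -> iota s \is a GRing.unit) /\
  (forall q : Q, exists (r s : R), GRing.lreg s /\ q = iota r / iota s).

Definition frac_mul (I J : set Q) : set Q :=
  [set q | exists (m : nat) (x y : 'I_m -> Q),
     (forall i, I (x i)) /\ (forall i, J (y i)) /\ q = \sum_i x i * y i].

Definition frac_one : set Q := range iota.

(* the inverse of I, when I is invertible *)
Definition frac_inv (I : set Q) : set Q :=
  [set q | forall x, I x -> frac_one (q * x)].

Definition Fitt_frac (M : lmodType R) : set Q := iota @` Fitt M.

End Fractional.

(** ** The exact sequences 0 -> N -> P_1 -> ... -> P_n -> M -> 0 *)

Section ExactSequences.
Variable M : lmodType R.

(* Exactness of 0 -> X_0 -> X_1 -> ... -> X_n --e--> M -> 0; the modules X_i for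
   i > n and the maps d_i for i >= n are irrelevant.  For n = 0, this is
   exactness of 0 -> X_0 --e--> M -> 0. *)
Definition is_exact (n : nat) (X : nat -> lmodType R)
    (d : forall i, {linear X i -> X i.+1}) : {linear X n -> M} -> Prop :=
  match n return {linear X n -> M} -> Prop with
  | 0 => fun e => injective e /\ surjective e
  | k.+1 => fun e =>
      injective (d 0) /\
      (forall i, (i < k)%N -> forall x, d i.+1 x = 0 <-> range (d i) x) /\
      (forall x, e x = 0 <-> range (d k) x) /\
      surjective e
  end.

Record exact_sequence (n : nat) := ExactSequence {
  es_mod :> nat -> lmodType R;
  es_map : forall i, {linear es_mod i -> es_mod i.+1};
  es_aug : {linear es_mod n -> M};
  es_exact : is_exact es_map es_aug
}.

(* (\prod_(1 <= i <= n) Fitt(P_i)^((-1)^i)) Fitt(N), where N = X_0, P_i = X_i *)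
Definition shifted_Fitt (Q : comUnitRingType) (iota : {rmorphism R -> Q})
    (n : nat) (X : exact_sequence n) : set Q :=
  frac_mul
    (\big[@frac_mul Q/frac_one iota]_(1 <= i < n.+1)
       if odd i then frac_inv iota (Fitt_frac iota (X i))
       else Fitt_frac iota (X i))
    (Fitt_frac iota (X 0)).

End ExactSequences.
End Modules.

(* Main.v *)
(* Over any commutative ring, a finitely generated module P which is killed by
   a regular element f and has projective dimension at most 1 is R^a / h R^b,
   where h R^b is projective and contains f R^a.  A splitting gives matrices g
   and E with h g = f and g h = f E, and Cauchy-Binet applied to h g shows that
   Fitt P is invertible.  If 0 -> A -> X -> P -> 0 is exact, X is presented by
   a block matrix [r, -t; 0, h] with t = t E; after multiplication by f^m, row
   operations remove t, whence Fitt X = Fitt A * Fitt P.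

   Induction on n: for covers P -> M <- P' with kernels B and B', the fibre
   product E sits in 0 -> B -> E -> P' -> 0 and 0 -> B' -> E -> P -> 0, so it
   suffices that a sequence for A gives one for an extension E of P by A with
   the invariant multiplied by Fitt(P)^((-1)^n).  One obtains it by comparing,
   through another fibre product, a cover of A with the restriction to A of a
   cover (R/f)^k of E.

   The arithmetic input is that a nonzero power series in T = gamma - 1 is a
   regular element of Z_p[[G]]: dividing by a power of p,
   if it kills y then T^(p^k) y = 0 modulo p for some k, so modulo p the
   coefficients of y are gamma^(p^k)-periodic, and the compatibility between
   consecutive levels makes them sums of p equal terms.  So p divides y, and
   one iterates. *)
From HB Require Import structures.
From mathcomp Require Import all_boot all_algebra all_fingroup all_field.
From mathcomp Require Import boolp classical_sets ring.
From mathcomp.multinomials Require freeg.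
Require Import Defs.
Set Implicit Arguments.
Unset Strict Implicit.
Unset Printing Implicit Defensive.
Import GRing.Theory.
Local Open Scope ring_scope.
Local Open Scope classical_set_scope.

(** * Determinants and ideals of minors *)

Section Determinants.
Variable R : comNzRingType.

(** Multilinearity of the determinant in the columns of [h *m w]; the terms with [s] not injective
    are kept although they vanish. *)
Lemma det_mulmx_expand (a b : nat) (h : 'M[R]_(a, b)) (w : 'M[R]_(b, a)) :
  \det (h *m w) = \sum_(s : {ffun 'I_a -> 'I_b}) (\prod_i w (s i) i) * \det (colsub s h).
Proof.
transitivity (\sum_(g : 'S_a) \sum_(s : {ffun 'I_a -> 'I_b})
   (\prod_i w (s i) i) * ((-1) ^+ g * \prod_i h (g i) (s i))).
  rewrite -det_tr; apply: eq_bigr => g _.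
  under eq_bigr => i _ do rewrite !mxE.
  rewrite bigA_distr_bigA mulr_sumr; apply: eq_bigr => s _.
  by rewrite mulrCA -big_split; congr (_ * _); apply: eq_bigr => i _; rewrite mulrC.
rewrite exchange_big; apply: eq_bigr => s _; rewrite -mulr_sumr -det_tr.
congr (_ * _); apply: eq_bigr => g _; congr (_ * _).
by apply: eq_bigr => i _; rewrite !mxE.
Qed.

Lemma det_colsub_perm (a b : nat) (h : 'M[R]_(a, b)) (s : 'I_a -> 'I_b) (g : 'S_a) :
  \det (colsub (s \o g) h) = (-1) ^+ g * \det (colsub s h).
Proof.
have -> : colsub (s \o g) h = col_perm g (colsub s h) by apply/matrixP=> i j; rewrite !mxE.
by rewrite col_permE det_mulmx det_perm odd_permV mulrC.
Qed.

Lemma det_colsub_eq0 (a b : nat) (h : 'M[R]_(a, b)) (s : 'I_a -> 'I_b) :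
  ~~ injectiveb s -> \det (colsub s h) = 0.
Proof.
case/injectivePn => i [j nij sij]; rewrite -det_tr.
by rewrite (determinant_alternate nij) // => k; rewrite !mxE sij.
Qed.

Lemma same_image_perm (a b : nat) (s t : {ffun 'I_a -> 'I_b}) :
  injective s -> s @: predT = t @: predT -> exists g : 'S_a, s = [ffun i => t (g i)].
Proof.
move=> injs st.
have ex i : exists j, s i == t j.
  have : s i \in t @: predT by rewrite -st imset_f.
  by case/imsetP => j _ ->; exists j.
pose g i := xchoose (ex i).
have gP i : s i = t (g i) by apply/eqP/(xchooseP (ex i)).
have injg : injective g by move=> i j gij; apply: injs; rewrite !gP gij.
by exists (perm injg); apply/ffunP => i; rewrite ffunE permE gP.
Qed.

(** [S] selects one injective map for each set of [a] columns, so that no ordering of the columns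
    has to be fixed. The injective maps with a given image are the permutations of the selected one,
    and their terms add up to a minor of [h] times a minor of [w]. [S] depends only on the sizes. *)
Lemma Cauchy_Binet (a b : nat) : exists S : pred {ffun 'I_a -> 'I_b},
  forall (h : 'M[R]_(a, b)) (w : 'M[R]_(b, a)),
  \det (h *m w) = \sum_(s | S s) \det (colsub s h) * \det (rowsub s w).
Proof.
pose F := {ffun 'I_a -> 'I_b}.
pose inj (s : F) := injectiveb s.
pose rep (A : {set 'I_b}) := [pick t : F | inj t && (t @: predT == A)].
(* The default [s] is never reached for an injective [s], which is itself a candidate for [rep]. *)
pose c (s : F) := odflt s (rep (s @: predT)).
have repP (s : F) : inj s -> inj (c s) /\ (c s) @: predT = s @: predT.
  move=> injs; rewrite /c /rep; case: pickP => /= [t /andP[injt /eqP ->] //|/(_ s)].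
  by rewrite injs eqxx.
have repE (s t : F) : inj s -> s @: predT = t @: predT -> c s = c t.
  by move=> injs st; rewrite /c /rep st; case: pickP => //= /(_ s); rewrite injs st eqxx.
exists (fun t => inj t && (c t == t)) => h w.
rewrite det_mulmx_expand (bigID inj) /= addrC big1 ?add0r => [|s ninjs]; last first.
  by rewrite det_colsub_eq0 ?mulr0.
rewrite (partition_big c (fun t => inj t && (c t == t))) => [|s injs]; last first.
  by have [-> E] := repP _ injs; rewrite (repE (c s) s) ?eqxx //; have [] := repP _ injs.
apply: eq_bigr => t /andP[injt /eqP ct].
pose f (g : 'S_a) : F := [ffun i => t (g i)].
have injf g : inj (f g).
  apply/injectiveP => i j; rewrite !ffunE => E.
  by apply: (@perm_inj _ g); apply: (injectiveP t).
have f_inj : injective f.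
  move=> g k /ffunP E; apply/permP => i; have := E i; rewrite !ffunE => E'.
  exact: (injectiveP t).
have imf g : f g @: predT = t @: predT.
  apply/setP => x; apply/imsetP/imsetP => [[i _ ->]|[i _ ->]].
    by exists (g i); rewrite ?ffunE.
  by exists ((g^-1)%g i) => //; rewrite ffunE permKV.
transitivity (\sum_(s in f @: predT) (\prod_i w (s i) i) * \det (colsub s h)).
  apply: eq_bigl => s; apply/andP/imsetP => [[injs /eqP cs]|[g _ ->]].
    have E : s @: predT = t @: predT by rewrite -cs; have [] := repP _ injs.
    by have [g ->] := same_image_perm (injectiveP s injs) E; exists g.
  by split => //; rewrite (repE _ t) ?ct.
rewrite big_imset /=; last by move=> ? ? _ _; apply: f_inj.
rewrite [RHS]mulrC -[\det (rowsub t w)]det_tr [in RHS]/determinant mulr_suml.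
apply: eq_big => [g|g _]; first by rewrite inE.
have -> : colsub (f g) h = colsub (t \o g) h by apply/matrixP=> i j; rewrite !mxE ffunE.
rewrite det_colsub_perm mulrA; congr (_ * _); rewrite mulrC; congr (_ * _).
by apply: eq_bigr => i _; rewrite !mxE ffunE.
Qed.

(** * Ideals, and the Laplace expansion as an ideal membership *)

Definition is_ideal (I : set R) : Prop :=
  [/\ I 0, forall x y, I x -> I y -> I (x + y) & forall r x, I x -> I (r * x)].

Lemma ideal_sum (I : set R) (T : Type) (r : seq T) (P : pred T) (F : T -> R) :
  is_ideal I -> (forall i, P i -> I (F i)) -> I (\sum_(i <- r | P i) F i).
Proof. by case=> I0 ID _ IF; elim/big_ind: _ => //; apply: ID. Qed.

(** A term of the Leibniz formula is nonzero only if its permutation matches the upper rows with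
    chosen columns of the left block and the lower rows with chosen columns of the right block. One
    such permutation reorders the chosen columns into a block diagonal matrix; if there is none, the
    minor is zero. *)
Lemma minor_block_diag (I : set R) (m a k l : nat) (c : 'M[R]_(m, k)) (d : 'M[R]_(a, l))
    (s : 'I_(m + a) -> 'I_(k + l)) : is_ideal I ->
  (forall s s', I (\det (colsub s c) * \det (colsub s' d))) ->
  I (\det (colsub s (block_mx c 0 0 d))).
Proof.
move=> idI Icd; set B := block_mx c 0 0 d.
pose ok (i : 'I_(m + a)) (j : 'I_(k + l)) := is_inl (split i) == is_inl (split j).
have B0 i j : ~~ ok i j -> B i j = 0.
  by rewrite /ok /B !mxE; case: split => ? /=; rewrite !mxE; case: split => ? //=; rewrite !mxE.
have [[g gok]|nog] := pselect (exists g : 'S_(m + a), forall i, ok i (s (g i))); last first.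
  rewrite /determinant; apply: ideal_sum => // g _.
  have [ok'|] := pselect (forall i, ok i (s (g i))); first by case: nog; exists g.
  move=> /existsNP[i /negP/B0 E]; rewrite (bigD1 i) //= [_ i (g i)]mxE E mul0r mulr0.
  by case: idI.
have -> : \det (colsub s B) = (-1) ^+ g * \det (colsub (s \o g) B).
  by rewrite det_colsub_perm mulrA -expr2 sqrr_sign mul1r.
case: (idI) => _ _ IM; apply: IM.
have exs1 i : exists j, s (g (lshift a i)) = lshift l j.
  have := gok (lshift a i); rewrite /ok (unsplitK (inl i)) /=.
  by case: split_ordP => /= j -> //; exists j.
pose s1 i := projT1 (cid (exs1 i)).
have s1P i : s (g (lshift a i)) = lshift l (s1 i) := projT2 (cid (exs1 i)).
have exs2 i : exists j, s (g (rshift m i)) = rshift k j.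
  have := gok (rshift m i); rewrite /ok (unsplitK (inr i)) /=.
  by case: split_ordP => /= j -> //; exists j.
pose s2 i := projT1 (cid (exs2 i)).
have s2P i : s (g (rshift m i)) = rshift k (s2 i) := projT2 (cid (exs2 i)).
have -> : colsub (s \o g) B = block_mx (colsub s1 c) 0 0 (colsub s2 d).
  apply/matrixP => i j; rewrite [LHS]mxE /=.
  case: (split_ordP i) => i' ->; case: (split_ordP j) => j' ->; rewrite ?s1P ?s2P;
  by rewrite ?block_mxEul ?block_mxEur ?block_mxEdl ?block_mxEdr !mxE.
by rewrite det_ublock.
Qed.

(** Laplace expansion along the first [m] rows; asking only for membership in [I] spares the signs.
    The stacked matrix is [block_mx c 0 0 d] times two stacked identity matrices. *)
Lemma Laplace_ideal (I : set R) (m a : nat) (c : 'M[R]_(m, m + a)) (d : 'M[R]_(a, m + a)) :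
  is_ideal I -> (forall s s', I (\det (colsub s c) * \det (colsub s' d))) ->
  I (\det (col_mx c d)).
Proof.
move=> idI Icd.
have -> : col_mx c d = block_mx c 0 0 d *m col_mx 1%:M 1%:M.
  by rewrite mul_block_col !mulmx1 addr0 add0r.
rewrite det_mulmx_expand; apply: ideal_sum => // s _.
by case: (idI) => _ _; apply; apply: minor_block_diag.
Qed.

(** The equality of sizes is propositional so that [a + a'] and [a' + a] are covered. *)
Lemma det_mulmxC (m n : nat) (A : 'M[R]_(m, n)) (B : 'M[R]_(n, m)) :
  m = n -> \det (A *m B) = \det (B *m A).
Proof. by move=> E; subst m; rewrite !det_mulmx mulrC. Qed.

Definition ideal_gen (S : set R) : set R :=
  [set x | forall I, is_ideal I -> S `<=` I -> I x].

Lemma ideal_gen_ideal (S : set R) : is_ideal (ideal_gen S).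
Proof.
split=> [I [] //|x y Sx Sy I idI SI|r x Sx I idI SI]; case: (idI) => _ ID IM.
  by apply: ID; [apply: Sx | apply: Sy].
by apply: IM; apply: Sx.
Qed.

Lemma ideal_gen_sub (S : set R) : S `<=` ideal_gen S.
Proof. by move=> x Sx I _; apply. Qed.

Lemma minors_ideal_is_ideal (a b : nat) (h : 'M[R]_(a, b)) : is_ideal (minors_ideal h).
Proof.
split=> [|x y [c ->] [c' ->]|r x [c ->]].
- by exists (fun=> 0); rewrite big1 // => s _; rewrite mul0r.
- exists (fun s => c s + c' s); rewrite -big_split.
  by apply: eq_bigr => s _; rewrite mulrDl.
- exists (fun s => r * c s); rewrite mulr_sumr.
  by apply: eq_bigr => s _; rewrite mulrA.
Qed.

Lemma minor_in (a b : nat) (h : 'M[R]_(a, b)) (s : 'I_a -> 'I_b) :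
  minors_ideal h (\det (colsub s h)).
Proof.
exists (fun t => (t == [ffun i => s i])%:R).
rewrite (bigD1 [ffun i => s i]) //= eqxx mul1r big1 ?addr0 => [|t /negPf ->].
  by congr (\det _); apply/matrixP => i j; rewrite !mxE ffunE.
by rewrite mul0r.
Qed.

Lemma minors_ideal_min (a b : nat) (h : 'M[R]_(a, b)) (I : set R) : is_ideal I ->
  (forall s, I (\det (colsub s h))) -> minors_ideal h `<=` I.
Proof.
by move=> idI Ih x [c ->]; apply: ideal_sum => // s _; case: (idI) => _ _; apply.
Qed.

Lemma det_mulmx_minors (a b : nat) (h : 'M[R]_(a, b)) (w : 'M[R]_(b, a)) :
  minors_ideal h (\det (h *m w)).
Proof.
rewrite det_mulmx_expand; apply: ideal_sum; first exact: minors_ideal_is_ideal.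
by move=> s _; case: (minors_ideal_is_ideal h) => _ _; apply; apply: minor_in.
Qed.

End Determinants.
(** * Kernels, cokernels and free covers *)

Section LinearMaps.
Variable R : comNzRingType.

Lemma linear_ex (U V : lmodType R) (f : U -> V) :
  (forall a x y, f (a *: x + y) = a *: f x + f y) -> exists g : {linear U -> V}, g =1 f.
Proof.
move=> lf; pose fL := GRing.isLinear.Build R U V _ f lf.
by exists (HB.pack_for {linear U -> V} f fL).
Qed.

Definition short_exact (A X P : lmodType R) (i : {linear A -> X}) (q : {linear X -> P}) :=
  [/\ injective i, forall x, q x = 0 <-> range i x & surjective q].

Section Kernel.
Variables (U V : lmodType R) (f : {linear U -> V}).

Definition ker_pred : {pred U} := fun x => f x == 0.

Lemma ker_pred_closed : submod_closed ker_pred.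
Proof.
split=> [|a x y]; rewrite !unfold_in ?linear0 // => /eqP fx /eqP fy.
by rewrite linearP fx fy scaler0 addr0.
Qed.

HB.instance Definition _ := GRing.isSubmodClosed.Build R U ker_pred ker_pred_closed.

Definition kernel := {x | x \in ker_pred}.
HB.instance Definition _ := SubChoice.on kernel.
HB.instance Definition _ := [SubChoice_isSubLmodule of kernel by <:].

Definition ker_incl : {linear kernel -> U} := val.

Lemma ker_incl_inj : injective ker_incl. Proof. exact: val_inj. Qed.

Lemma ker_inclP x : f x = 0 <-> range ker_incl x.
Proof.
split=> [fx|[[y yf] _ <-]]; last exact/eqP.
have kx : x \in ker_pred by rewrite unfold_in fx.
by exists (exist _ x kx).
Qed.
End Kernel.

Section Cokernel.
Variables (U V : lmodType R) (f : {linear U -> V}).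

(** One representative is chosen in each coset of the image; [coker] consists of the chosen elements
    and carries the quotient module. *)
Definition coker_repr (x : V) : V := xget 0 [set y | range f (x - y)].

Lemma coker_reprP x : range f (x - coker_repr x).
Proof.
by rewrite /coker_repr; case: xgetP => [y -> //|/(_ x)] /=;
  rewrite subrr => -[]; exists 0; rewrite ?linear0.
Qed.

Lemma range_linear a x y : range f x -> range f y -> range f (a *: x + y).
Proof. by move=> [u _ <-] [v _ <-]; exists (a *: u + v); rewrite ?linearP. Qed.

Lemma coker_repr_eq x y : coker_repr x = coker_repr y <-> range f (x - y).
Proof.
have rN z : range f z -> range f (- z).
  by move=> rz; rewrite -[- z]addr0 -scaleN1r; apply: range_linear => //; exists 0; rewrite ?linear0.
have rD z t : range f z -> range f t -> range f (z + t).
  by move=> rz; rewrite -[z]scale1r; apply: range_linear.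
split=> [E|rxy].
  have := rD _ _ (coker_reprP x) (rN _ (coker_reprP y)).
  by rewrite E opprB addrA subrK.
rewrite /coker_repr; congr xget; apply/seteqP; split=> z /= rz.
  by have := rD _ _ rz (rN _ rxy); rewrite opprB addrC addrA subrK.
by have := rD _ _ rxy rz; rewrite addrA subrK.
Qed.

Lemma coker_reprK x : coker_repr (coker_repr x) = coker_repr x.
Proof.
apply/esym/coker_repr_eq; exact: coker_reprP.
Qed.

Definition coker := {x : V | coker_repr x == x}.
HB.instance Definition _ := SubChoice.on coker.

Definition coker_proj (x : V) : coker :=
  exist _ (coker_repr x) (introT eqP (coker_reprK x)).

Lemma coker_projE x y : coker_proj x = coker_proj y <-> range f (x - y).
Proof.
rewrite -coker_repr_eq; split=> [/(congr1 val) //|E]; exact: val_inj.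
Qed.

Lemma coker_projK (q : coker) : coker_proj (val q) = q.
Proof. by apply: val_inj => /=; apply/eqP; case: q. Qed.

Let add (q r : coker) := coker_proj (val q + val r).
Let opp (q : coker) := coker_proj (- val q).
Let scale a (q : coker) := coker_proj (a *: val q).

(** Both operations on cosets are well defined by this one computation: [a = 1] gives addition,
    [y = 0] gives scaling. *)
Let range_repr a x y : coker_proj (a *: val (coker_proj x) + y) = coker_proj (a *: x + y).
Proof.
apply/coker_projE; rewrite opprD addrACA subrr addr0 -scalerBr -[X in range f X]addr0.
apply: range_linear; last by exists 0; rewrite ?linear0.
by have [u _ E] := coker_reprP x; exists (- u) => //; rewrite linearN E opprB.
Qed.

Let addp x y : coker_proj (val (coker_proj x) + y) = coker_proj (x + y).
Proof. by have := range_repr 1 x y; rewrite !scale1r. Qed.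
Let addpr x y : coker_proj (y + val (coker_proj x)) = coker_proj (y + x).
Proof. by rewrite addrC addp addrC. Qed.
Let scalep a x : coker_proj (a *: val (coker_proj x)) = coker_proj (a *: x).
Proof. by have := range_repr a x 0; rewrite !addr0. Qed.

Let addA : associative add.
Proof. by move=> x y z; rewrite /add addp addpr addrA. Qed.
Let addC : commutative add.
Proof. by move=> x y; rewrite /add addrC. Qed.
Let add0 : left_id (coker_proj 0) add.
Proof. by move=> x; rewrite /add addp add0r coker_projK. Qed.
Let addN : left_inverse (coker_proj 0) opp add.
Proof. by move=> x; rewrite /add addp addNr. Qed.

HB.instance Definition _ := GRing.isZmodule.Build coker addA addC add0 addN.

Let scaleA a b x : scale a (scale b x) = scale (a * b) x.
Proof. by rewrite /scale scalep scalerA. Qed.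
Let scale1 x : scale 1 x = x.
Proof. by rewrite /scale scale1r coker_projK. Qed.
Let scaleDr a : {morph scale a : x y / x + y}.
Proof. by move=> x y; rewrite /scale /= scalep scalerDr [RHS]addp addpr. Qed.
Let scaleDl x : {morph scale^~ x : a b / a + b}.
Proof. by move=> a b; rewrite /scale /= scalerDl [RHS]addp addpr. Qed.

HB.instance Definition _ :=
  GRing.Zmodule_isLmodule.Build R coker scaleA scale1 scaleDr scaleDl.

Lemma coker_ex : exists q : {linear V -> coker},
  surjective q /\ forall x, q x = 0 <-> range f x.
Proof.
have [|q qE] := @linear_ex V coker coker_proj.
  by move=> a x y; rewrite [RHS]addp addpr /= range_repr.
exists q; split=> [y|x]; first by exists (val y); rewrite qE coker_projK.
by rewrite qE -[X in range f X]subr0 -coker_projE.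
Qed.
End Cokernel.

Lemma lin_factor_inj (A B U : lmodType R) (i : {linear A -> B}) (f : {linear U -> B}) :
  injective i -> (forall x, range i (f x)) -> exists g : {linear U -> A}, forall x, i (g x) = f x.
Proof.
move=> inji ri; have ex x : exists y, i y = f x by have [y _ E] := ri x; exists y.
pose g x := projT1 (cid (ex x)).
have gP x : i (g x) = f x := projT2 (cid (ex x)).
have [a x y|h hE] := @linear_ex _ _ g; first by apply: inji; rewrite linearP !gP linearP.
by exists h => x; rewrite hE.
Qed.

Lemma colvec_lift (a : nat) (A B : lmodType R) (q : {linear A -> B}) (f : {linear 'cV[R]_a -> B}) :
  surjective q -> exists g : {linear 'cV[R]_a -> A}, forall x, q (g x) = f x.
Proof.
move=> surq; pose v j := projT1 (cid (surq (f (delta_mx j 0)))).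
have vP j : q (v j) = f (delta_mx j 0) := projT2 (cid (surq (f (delta_mx j 0)))).
have [c x y|g gE] := @linear_ex _ _ (fun x : 'cV[R]_a => \sum_j x j 0 *: v j).
  rewrite scaler_sumr -big_split; apply: eq_bigr => j _ /=.
  by rewrite !mxE scalerDl scalerA.
exists g => x; rewrite gE linear_sum [x in RHS]matrix_sum_delta linear_sum; apply: eq_bigr => j _.
by rewrite big_ord1 !linearZ /= vP.
Qed.

Lemma colvec_projective (a : nat) : is_projective ('cV[R]_a : lmodType R).
Proof. by move=> A B f g /colvec_lift; apply. Qed.

Lemma fg_surj (M : lmodType R) : finitely_generated M ->
  exists a (e : {linear 'cV[R]_a -> M}), surjective e.
Proof.
move=> [a [v vP]]; exists a.
have [c x y|g gE] := @linear_ex _ _ (fun x : 'cV[R]_a => \sum_j x j 0 *: v j).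
  rewrite scaler_sumr -big_split; apply: eq_bigr => j _ /=.
  by rewrite !mxE scalerDl scalerA.
exists g => x; have [c ->] := vP x; exists (\col_j c j); rewrite gE.
by apply: eq_bigr => j _; rewrite mxE.
Qed.

Lemma surj_fg (M : lmodType R) (a : nat) (e : {linear 'cV[R]_a -> M}) :
  surjective e -> finitely_generated M.
Proof.
move=> se; exists a, (fun j => e (delta_mx j 0)) => x; have [w <-] := se x.
exists (fun j => w j 0); rewrite {1}[w]matrix_sum_delta linear_sum; apply: eq_bigr => j _.
by rewrite big_ord1 linearZ.
Qed.

Lemma colvec_linear_matrix (a b : nat) (f : {linear 'cV[R]_b -> 'cV[R]_a}) :
  exists h : 'M[R]_(a, b), forall w, f w = h *m w.
Proof.
exists (\matrix_(i, j) f (delta_mx j 0) i 0) => w.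
rewrite [w in LHS]matrix_sum_delta linear_sum; apply/colP => i.
rewrite mxE summxE; apply: eq_bigr => j _.
by rewrite big_ord1 linearZ !mxE mulrC.
Qed.

End LinearMaps.

(** * Dual bases of projective modules *)

Section DualBasis.
Variable R : comNzRingType.
Import freeg.

(** The canonical map from the free module on the underlying set of [K] onto [K]. *)
Definition fgsum (K : lmodType R) (D : {freeg K / R}) : K :=
  \sum_(x <- dom D) coeff x D *: x.

Lemma fgsumE (K : lmodType R) (S : seq K) (D : {freeg K / R}) : uniq S ->
  (forall x, x \notin S -> coeff x D = 0) -> fgsum D = \sum_(x <- S) coeff x D *: x.
Proof.
move=> uS DS; rewrite [RHS](bigID (fun x => x \in dom D)) /= [X in _ = _ + X]big1 => [|x].
  rewrite addr0 -big_filter; apply/perm_big/uniq_perm; rewrite ?uniq_dom ?filter_uniq //.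
  move=> x; rewrite mem_filter; apply/idP/andP => [xD|[]//]; split=> //.
  by apply: contraT => /DS; move: xD; rewrite mem_dom => /eqP.
by rewrite mem_dom negbK => /eqP ->; rewrite scale0r.
Qed.

Lemma fgsum_linear (K : lmodType R) c (x y : {freeg K / R}) :
  fgsum (c *: x + y) = c *: fgsum x + fgsum y.
Proof.
have [S [uS xS yS]] : exists S, [/\ uniq S, forall z, z \notin S -> coeff z x = 0 &
    forall z, z \notin S -> coeff z y = 0].
  exists (undup (dom x ++ dom y)); split; first exact: undup_uniq.
    by move=> z; rewrite mem_undup mem_cat negb_or => /andP[/coeff_outdom].
  by move=> z; rewrite mem_undup mem_cat negb_or => /andP[_ /coeff_outdom].
rewrite !(fgsumE uS) // => [|z zS]; last by rewrite coeffD coeffZ xS // yS // mulr0 addr0.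
rewrite scaler_sumr -big_split; apply: eq_bigr => z _ /=.
by rewrite coeffD coeffZ scalerDl scalerA.
Qed.

(* A projective submodule of R^a containing f R^a is finitely generated: the
   dual basis coordinates which vanish on f R^a vanish everywhere. *)
Lemma dual_basis (K : lmodType R) (a : nat) (j : {linear K -> 'cV[R]_a}) (f : R) :
  is_projective K -> injective j -> GRing.lreg f -> (forall v, range j (f *: v)) ->
  exists b (h : 'M[R]_(a, b)) (s : {linear K -> 'cV[R]_b}),
    (forall w, range j (h *m w)) /\ forall x, h *m s x = j x.
Proof.
move=> projK injj regf fj.
have [pr prE] := linear_ex (@fgsum_linear K).
have surpr : surjective pr.
  by move=> x; exists << x >>; rewrite prE /fgsum domU1 big_seq1 coeffU eqxx mulr1 scale1r.
have [s0 s0K] := projK _ _ pr (idfun : {linear K -> K}) surpr.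
have [c u v|fL fLE] := @linear_ex R 'cV[R]_a 'cV[R]_a (fun v => f *: v).
  by rewrite scalerDr !scalerA mulrC.
have [v|r rK] := lin_factor_inj (f := fL) injj; first by rewrite fLE.
have {}rK v : j (r v) = f *: v by rewrite rK fLE.
(* The finitely many coordinates that occur on the elements [r (delta_mx i 0)], of which every
   [f *: x] is a combination. *)
pose S := undup (flatten [seq dom (s0 (r (delta_mx i 0))) | i <- enum 'I_a]).
have s0S x k : k \notin S -> coeff k (s0 x) = 0.
  move=> kS; apply: regf; rewrite mulr0 -coeffZ -linearZ /=.
  have -> : f *: x = r (j x) by apply: injj; rewrite rK linearZ.
  rewrite [j x]matrix_sum_delta !linear_sum raddf_sum; apply: big1 => i _ /=.
  rewrite big_ord1 !linearZ /= coeffZ.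
  suff -> : coeff k (s0 (r (delta_mx i 0))) = 0 by rewrite mulr0.
  apply: coeff_outdom; apply: contra kS => kd; rewrite mem_undup.
  by apply/flattenP; exists (dom (s0 (r (delta_mx i 0)))) => //;
    apply: (map_f (fun i => dom (s0 (r (delta_mx i 0))))); rewrite mem_enum.
pose t := in_tuple S.
have [c x y|s sE] := @linear_ex R K 'cV[R]_(size S) (fun x => \col_i coeff (tnth t i) (s0 x)).
  by apply/colP => i; rewrite !mxE linearP coeffD coeffZ.
exists (size S), (\matrix_(i, k) j (tnth t k) i 0), s; split=> [w|x].
  exists (\sum_k w k 0 *: tnth t k) => //.
  rewrite linear_sum; apply/colP => i; rewrite summxE mxE; apply: eq_bigr => k _.
  by rewrite linearZ !mxE mulrC.
have E : x = pr (s0 x) by rewrite s0K.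
rewrite [in RHS]E prE (@fgsumE _ S) ?undup_uniq //; last by move=> k; apply: s0S.
rewrite linear_sum (big_tnth _ _ S) /=; apply/colP => i; rewrite summxE mxE; apply: eq_bigr => k _.
by rewrite linearZ sE !mxE mulrC.
Qed.
End DualBasis.
(** * Fitting ideals *)

Section FittingIdeals.
Variable R : comNzRingType.

Lemma mulmx_ext (m n : nat) (A B : 'M[R]_(m, n)) :
  (forall w : 'cV[R]_n, A *m w = B *m w) -> A = B.
Proof.
move=> AB; apply/matrixP => i j; have /colP/(_ i) := AB (delta_mx j 0).
by rewrite -!colE !mxE.
Qed.

Lemma scalemx_reg (m n : nat) (f : R) (A B : 'M[R]_(m, n)) :
  GRing.lreg f -> f *: A = f *: B -> A = B.
Proof.
move=> regf /matrixP AB; apply/matrixP => i j; apply: regf.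
by have := AB i j; rewrite !mxE.
Qed.

Lemma mulmx_factor (a b c : nat) (h : 'M[R]_(a, b)) (D : 'M[R]_(a, c)) :
  (forall w : 'cV[R]_c, exists w', D *m w = h *m w') -> exists W, D = h *m W.
Proof.
move=> ex; pose v j := projT1 (cid (ex (delta_mx j 0))).
have vP j : D *m delta_mx j 0 = h *m v j := projT2 (cid (ex (delta_mx j 0))).
exists (\matrix_(i, j) v j i 0); apply/matrixP => i j.
have /colP/(_ i) := vP j; rewrite -colE !mxE => ->.
by apply: eq_bigr => k _; rewrite mxE.
Qed.

(* The image of h is a projective submodule of R^a containing f R^a: the map
   h w |-> E w splits h, and g is this splitting restricted to f R^a. *)
Definition split_relations (a b : nat) (f : R) (h : 'M[R]_(a, b)) (g : 'M[R]_(b, a))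
    (E : 'M[R]_b) : Prop :=
  [/\ GRing.lreg f, h *m g = f%:M & g *m h = f *: E].

(** The zero module on [a] generators; it lets redundant generators be treated as an extension by
    the zero module. *)
Lemma split_relations1 (a : nat) : split_relations 1 (1%:M : 'M[R]_a) 1%:M 1%:M.
Proof. by split; rewrite ?scale1r ?mulmx1 //; apply: lreg1. Qed.

Section SplitRelations.
Variables (a b : nat) (f : R) (h : 'M[R]_(a, b)) (g : 'M[R]_(b, a)) (E : 'M[R]_b).
Hypothesis hgE : split_relations f h g E.

Lemma split_relations_hE : h *m E = h.
Proof.
case: hgE => regf hg gh; apply: (scalemx_reg regf).
by rewrite scalemxAr -gh mulmxA hg mul_scalar_mx.
Qed.

Lemma split_relations_EE : E *m E = E.
Proof.
case: (hgE) => regf hg gh; apply: (scalemx_reg regf).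
by rewrite scalemxAl -gh -mulmxA split_relations_hE.
Qed.

Lemma split_relations_E0 c (w : 'M[R]_(b, c)) : h *m w = 0 -> E *m w = 0.
Proof.
case: (hgE) => regf hg gh hw; apply: (scalemx_reg regf).
by rewrite scalemxAl -gh -mulmxA hw mulmx0 scaler0.
Qed.

(** The minor of [g *m h = f *: E] on rows [t] and columns [s]. It shows that [\det (rowsub t g)]
    divided by [f ^+ a] multiplies the minors of [h] into [R]. *)
Lemma det_minors_prod (s t : 'I_a -> 'I_b) :
  \det (colsub s h) * \det (rowsub t g) = f ^+ a * \det (mxsub t s E).
Proof.
case: hgE => regf hg gh; rewrite mulrC -det_mulmx -detZ; congr (\det _).
apply/matrixP => i j; have /matrixP/(_ (t i) (s j)) := gh; rewrite !mxE => <-.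
by apply: eq_bigr => k _; rewrite !mxE.
Qed.
End SplitRelations.

(** A form of the Fitting ideal that depends only on the generators [e] and makes sense without a
    finite presentation: it is generated by the determinants of square matrices of relations. *)
Definition fitt_gen (M : lmodType R) (a : nat) (e : {linear 'cV[R]_a -> M}) : set R :=
  ideal_gen [set x | exists2 H : 'M[R]_a, (forall w : 'cV[R]_a, e (H *m w) = 0) & x = \det H].

Lemma fitt_gen_ideal (M : lmodType R) (a : nat) (e : {linear 'cV[R]_a -> M}) :
  is_ideal (fitt_gen e).
Proof. exact: ideal_gen_ideal. Qed.

Lemma det_fitt_gen (M : lmodType R) (a : nat) (e : {linear 'cV[R]_a -> M}) (H : 'M[R]_a) :
  (forall w : 'cV[R]_a, e (H *m w) = 0) -> fitt_gen e (\det H).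
Proof. by move=> eH; apply: ideal_gen_sub; exists H. Qed.

(** A maximal minor of [h] comes from a square matrix of relations; conversely a square matrix of
    relations factors through [h], so its determinant is a combination of minors. *)
Lemma presented_fitt_gen (M : lmodType R) (a b : nat) (h : 'M[R]_(a, b))
    (e : {linear 'cV[R]_a -> M}) : is_presentation h e -> minors_ideal h = fitt_gen e.
Proof.
move=> [_ kh]; apply/seteqP; split.
  apply: minors_ideal_min => [|s]; first exact: fitt_gen_ideal.
  have -> : colsub s h = h *m colsub s 1%:M by rewrite mulmx_colsub mulmx1.
  by apply: det_fitt_gen => w; apply/kh; exists (colsub s 1%:M *m w); rewrite mulmxA.
move=> x; apply; first exact: minors_ideal_is_ideal.
move=> _ [H eH ->].
have [|W ->] := @mulmx_factor _ _ _ h H; last exact: det_mulmx_minors.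
by move=> w; apply/kh.
Qed.

(** * Fitting ideals of extensions, with the quotient described by its relations [h] *)

Section Extension.
Variables (A X : lmodType R) (i : {linear A -> X}) (m a b : nat).
Variables (eA : {linear 'cV[R]_m -> A}) (xt : {linear 'cV[R]_a -> X}).
Variables (eX : {linear 'cV[R]_(m + a) -> X}).
Variables (f : R) (h : 'M[R]_(a, b)) (g : 'M[R]_(b, a)) (E : 'M[R]_b).
Hypothesis i_inj : injective i.
Hypothesis eA_surj : surjective eA.
Hypothesis eXE : forall u v, eX (col_mx u v) = i (eA u) + xt v.
Hypothesis hgE : split_relations f h g E.
Hypothesis xth : forall v, range i (xt v) <-> exists w, v = h *m w.

(** For each relation [h *m w] of the quotient, [xt (h *m w)] lies in [A], and [t *m w] expresses it
    in the generators [eA]. A first lift [t0] is replaced by [t0 *m E], which forces [t] to vanish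
    on the kernel of [h]. *)
Lemma ext_relations : exists t : 'M[R]_(m, b), t *m E = t /\
  forall u v, eX (col_mx u v) = 0 <-> exists2 w, v = h *m w & eA (u + t *m w) = 0.
Proof.
have [c x y|xh xhE] := @linear_ex R 'cV[R]_b X (fun w => xt (h *m w)).
  by rewrite linearP /= linearP.
have [w|y yK] := lin_factor_inj (f := xh) i_inj.
  by rewrite xhE; apply/xth; exists w.
have [z zK] := colvec_lift y eA_surj.
have [t0 t0E] := colvec_linear_matrix z.
have t0K w : i (eA (t0 *m w)) = xt (h *m w) by rewrite -t0E zK yK xhE.
have tK w : i (eA (t0 *m E *m w)) = xt (h *m w).
  by rewrite -mulmxA t0K mulmxA (split_relations_hE hgE).
exists (t0 *m E); split; first by rewrite -mulmxA (split_relations_EE hgE).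
move=> u v; rewrite eXE; split=> [E0|[w -> E0]].
  have [w vw] : exists w, v = h *m w.
    apply/xth; exists (eA (- u)) => //.
    by apply/eqP; rewrite linearN linearN /= -subr_eq0 -opprD oppr_eq0 E0.
  by exists w => //; apply: i_inj; rewrite linear0 linearD linearD tK -vw.
by rewrite -tK -linearD -linearD E0 linear0.
Qed.

(** A square relation matrix of [X] has lower part [D = h *m W]; adding [t *m W] to its upper part
    gives relations of [A] without changing the determinant, and the Laplace expansion concludes.
    The ideal [I] is arbitrary so that it can be the preimage of a fractional ideal. *)
Lemma fitt_ext_le (I : set R) : is_ideal I ->
  (forall H : 'M[R]_m, (forall w : 'cV[R]_m, eA (H *m w) = 0) ->
     forall y, minors_ideal h y -> I (\det H * y)) ->
  fitt_gen eX `<=` I.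
Proof.
move=> idI IA x; apply=> // _ [H eH ->].
have [t [tE kX]] := ext_relations; have [regf hg gh] := hgE.
have HE : H = col_mx (usubmx H) (dsubmx H) by rewrite vsubmxK.
set C := usubmx H in HE; set D := dsubmx H in HE.
have eH' w : exists2 w', D *m w = h *m w' & eA (C *m w + t *m w') = 0.
  by apply/kX; rewrite -mul_col_mx -HE eH.
have [|W DW] := @mulmx_factor _ _ _ h D.
  by move=> w; have [w' ? _] := eH' w; exists w'.
pose C' := C + t *m W.
(* The [w'] provided by [eH'] and [W *m w] differ by an element of the kernel of [h], where [t]
   vanishes. *)
have eC' w : eA (C' *m w) = 0.
  have [w' Dw <-] := eH' w; congr (eA _); rewrite mulmxDl; congr (_ + _).
  apply/eqP; rewrite -subr_eq0 -mulmxA -mulmxBr -tE -mulmxA.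
  rewrite (split_relations_E0 hgE) ?mulmx0 //.
  by rewrite mulmxBr mulmxA -DW Dw subrr.
(* After scaling by [f], the added rows are combinations of the rows of [D]: [t *m g *m D] equals
   [f *: (t *m W)] because [t *m E = t]. The determinants are therefore compared after
   multiplication by the regular element [f ^+ m]. *)
have -> : \det H = \det (col_mx C' D).
  apply: (@lregX _ f m) => //.
  have <- : \det (block_mx (f%:M : 'M_m) (t *m g) 0 (1%:M : 'M_a)) = f ^+ m.
    by rewrite det_ublock det_scalar det1 mulr1.
  have {2}-> : \det (block_mx (f%:M : 'M_m) (t *m g) 0 (1%:M : 'M_a)) =
     \det (block_mx (f%:M : 'M_m) 0 0 (1%:M : 'M_a)) by rewrite !det_ublock.
  rewrite -!det_mulmx HE !mul_block_col !mul0mx !add0r addr0 !mul1mx !mul_scalar_mx.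
  congr (\det (col_mx _ _)); rewrite scalerDr; congr (_ + _).
  by rewrite DW mulmxA -(mulmxA t) gh -scalemxAr tE -scalemxAl.
apply: Laplace_ideal => // s s'; apply: IA => [w|].
  have -> : colsub s C' = C' *m colsub s 1%:M by rewrite mulmx_colsub mulmx1.
  by rewrite -mulmxA eC'.
have -> : colsub s' D = h *m (W *m colsub s' 1%:M) by rewrite mulmxA -DW mulmx_colsub mulmx1.
exact: det_mulmx_minors.
Qed.

(** The block triangular matrix with diagonal blocks [H] and [colsub s h], and corner
    [- (t *m colsub s 1%:M)], consists of relations of [X]. *)
Lemma fitt_ext_ge x y : fitt_gen eA x -> minors_ideal h y -> fitt_gen eX (x * y).
Proof.
have [t [tE kX]] := ext_relations; have [I0 ID IM] := fitt_gen_ideal eX.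
move=> xA yh; apply: (xA (fun x => fitt_gen eX (x * y))).
  by split=> [|? ? ? ?|r ? ?]; rewrite ?mul0r ?mulrDl -?mulrA; [ | apply: ID | apply: IM].
move=> _ [H eH ->]; move: y yh; apply: minors_ideal_min.
  by split=> [|? ? ? ?|r ? ?]; rewrite ?mulr0 ?mulrDr ?(mulrCA _ r); [ | apply: ID | apply: IM].
move=> s; rewrite -(det_ublock H (- (t *m colsub s 1%:M))); apply: det_fitt_gen => w.
rewrite -[w]vsubmxK mul_block_col mul0mx add0r; apply/kX.
exists (colsub s 1%:M *m dsubmx w); first by rewrite mulmxA mulmx_colsub mulmx1.
by rewrite mulNmx mulmxA subrK eH.
Qed.

Lemma ext_presented : (exists k (r : 'M[R]_(m, k)), is_presentation r eA) ->
  surjective eX -> exists k (r : 'M[R]_(m + a, k)), is_presentation r eX.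
Proof.
have [t [tE kX]] := ext_relations.
move=> [k [r [_ kr]]] seX; exists (k + b)%N, (block_mx r (- t) 0 h); split=> // v.
rewrite -{1}[v]vsubmxK; split=> [/kX[w vw /kr[u E0]]|[w ->]].
  exists (col_mx u w); rewrite mul_block_col mul0mx add0r -vw mulNmx -E0 addrK.
  by rewrite vsubmxK.
rewrite -[w]vsubmxK mul_block_col mul0mx add0r col_mxKu col_mxKd.
apply/kX; exists (dsubmx w) => //; apply/kr; exists (usubmx w).
by rewrite mulNmx subrK.
Qed.

(** Adding [t *m W] to the upper rows of [r], where [h *m W] is its lower part, turns relations of
    [X] into relations of [A]. *)
Lemma presented_ext : (exists k (r : 'M[R]_(m + a, k)), is_presentation r eX) ->
  exists k (r : 'M[R]_(m, k)), is_presentation r eA.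
Proof.
have [t [tE kX]] := ext_relations.
move=> [k [r [_ kr]]]; have [|W DW] := @mulmx_factor _ _ _ h (dsubmx r).
  move=> w; have : eX (r *m w) = 0 by apply/kr; exists w.
  by rewrite -[r]vsubmxK mul_col_mx => /kX[w' E' _]; exists w'; rewrite col_mxKd.
exists k, (usubmx r + t *m W); split=> // u; split=> [eu|[w ->]].
  have : eX (col_mx u 0) = 0.
    by apply/kX; exists 0; rewrite ?mulmx0 ?addr0.
  move=> /kr[w E0]; exists w; move: E0.
  rewrite -{1}[r]vsubmxK mul_col_mx => /eq_col_mx[-> /esym D0].
  rewrite mulmxDl -mulmxA -tE -mulmxA (split_relations_E0 hgE) ?mulmx0 ?addr0 //.
  by rewrite mulmxA -DW.
have : eX (r *m w) = 0 by apply/kr; exists w.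
rewrite -{1}[r]vsubmxK mul_col_mx => /kX[w' E' <-]; congr (eA _).
rewrite mulmxDl; congr (_ + _); apply/eqP; rewrite -subr_eq0 -mulmxA -mulmxBr -tE -mulmxA.
by rewrite (split_relations_E0 hgE) ?mulmx0 // mulmxBr mulmxA -DW E' subrr.
Qed.
End Extension.

End FittingIdeals.

(** * Independence of the Fitting ideal from the generators *)

Section FittingInvariance.
Variable R : comNzRingType.

Lemma copair_ex (m a : nat) (X : lmodType R) (f : {linear 'cV[R]_m -> X})
    (g : {linear 'cV[R]_a -> X}) :
  exists c : {linear 'cV[R]_(m + a) -> X}, forall u v, c (col_mx u v) = f u + g v.
Proof.
have [k x y|c cE] := @linear_ex R 'cV[R]_(m + a) X (fun w => f (usubmx w) + g (dsubmx w)).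
  by rewrite !linearP /= scalerDr addrACA.
by exists c => u v; rewrite cE col_mxKu col_mxKd.
Qed.

Section ChangeOfGenerators.
Variables (M : lmodType R) (n n' : nat).
Variables (e : {linear 'cV[R]_n -> M}) (e' : {linear 'cV[R]_n' -> M}).
Variables (S : 'M[R]_(n', n)) (S' : 'M[R]_(n, n')).
Hypotheses (enn' : n = n') (SS' : S *m S' = 1%:M) (S'S : S' *m S = 1%:M).
Hypothesis e'S : forall w, e' (S *m w) = e w.

Lemma fitt_gen_iso : fitt_gen e `<=` fitt_gen e'.
Proof.
move=> x; apply; first exact: fitt_gen_ideal.
move=> _ [H eH ->].
have -> : \det H = \det (S *m (H *m S')) by rewrite det_mulmxC // -mulmxA S'S mulmx1.
by apply: det_fitt_gen => w; rewrite -!mulmxA e'S eH.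
Qed.

Lemma presentation_iso b (h : 'M[R]_(n, b)) :
  is_presentation h e -> is_presentation (S *m h) e'.
Proof.
move=> [se ke]; split=> [x|v]; first by have [w <-] := se x; exists (S *m w).
rewrite -[v]mul1mx -SS' -mulmxA e'S; split=> [/ke[w ->]|[w E]].
  by exists w; rewrite mulmxA.
by apply/ke; exists w; have := congr1 (mulmx S') E; rewrite !mulmxA S'S !mul1mx.
Qed.
End ChangeOfGenerators.

Section TwoGenerators.
Variables (M : lmodType R) (a a' : nat).
Variables (e : {linear 'cV[R]_a -> M}) (e' : {linear 'cV[R]_a' -> M}).
Hypotheses (se : surjective e) (se' : surjective e').

Let id_inj : injective (idfun : {linear M -> M}). Proof. by move=> ? ?. Qed.

Let full_relations (k : nat) (e1 : {linear 'cV[R]_k -> M}) (v : 'cV[R]_k) :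
  range (idfun : {linear M -> M}) (e1 v) <-> exists w, v = 1%:M *m w.
Proof. by split=> _; [exists v; rewrite mul1mx | exists (e1 v)]. Qed.

Lemma copair_surj (k : nat) (e1 : {linear 'cV[R]_k -> M}) (c : {linear 'cV[R]_(a + k) -> M}) :
  (forall u v, c (col_mx u v) = e u + e1 v) -> surjective c.
Proof.
by move=> cE x; have [u <-] := se x; exists (col_mx u 0); rewrite cE linear0 addr0.
Qed.

(** The extension results apply with [A = X = M] and the identity map: the generators [e'] are
    redundant, and every vector is a relation of the zero quotient. *)
Lemma fitt_gen_copair (c : {linear 'cV[R]_(a + a') -> M}) :
  (forall u v, c (col_mx u v) = e u + e' v) -> fitt_gen c = fitt_gen e.
Proof.
move=> cE; have [I0 ID IM] := fitt_gen_ideal e; apply/seteqP; split.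
  apply: (fitt_ext_le id_inj se cE (@split_relations1 R a') (full_relations e')).
    exact: fitt_gen_ideal.
  by move=> H eH y _; rewrite mulrC; apply: IM; apply: det_fitt_gen.
move=> x ex; rewrite -[x]mulr1.
apply: (fitt_ext_ge id_inj se cE (@split_relations1 R a') (full_relations e')) => //.
by have := det_mulmx_minors (1%:M : 'M[R]_a') 1%:M; rewrite mulmx1 det1.
Qed.

End TwoGenerators.

Definition swap_mx (a a' : nat) : 'M[R]_(a' + a, a + a') := block_mx 0 1%:M 1%:M 0.

Lemma swap_mxK (a a' : nat) : swap_mx a a' *m swap_mx a' a = 1%:M.
Proof.
rewrite /swap_mx mulmx_block !mulmx1 !mulmx0 !addr0 !add0r.
by rewrite -scalar_mx_block.
Qed.

Lemma copair_swap (M : lmodType R) (a a' : nat) (e : {linear 'cV[R]_a -> M})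
    (e' : {linear 'cV[R]_a' -> M}) (c : {linear 'cV[R]_(a + a') -> M})
    (c' : {linear 'cV[R]_(a' + a) -> M}) :
  (forall u v, c (col_mx u v) = e u + e' v) -> (forall u v, c' (col_mx u v) = e' u + e v) ->
  forall w, c' (swap_mx a a' *m w) = c w.
Proof.
move=> cE c'E w; rewrite -[w]vsubmxK mul_block_col !mul0mx !mul1mx addr0 add0r.
by rewrite cE c'E addrC.
Qed.

Lemma fitt_gen_unique (M : lmodType R) (a a' : nat) (e : {linear 'cV[R]_a -> M})
    (e' : {linear 'cV[R]_a' -> M}) :
  surjective e -> surjective e' -> fitt_gen e = fitt_gen e'.
Proof.
move=> se se'; have [c cE] := copair_ex e e'; have [c' c'E] := copair_ex e' e.
rewrite -(fitt_gen_copair se cE) -(fitt_gen_copair se' c'E); apply/seteqP; split.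
  apply: (fitt_gen_iso (addnC _ _) (swap_mxK _ _)); exact: copair_swap cE c'E.
apply: (fitt_gen_iso (addnC _ _) (swap_mxK _ _)); exact: copair_swap c'E cE.
Qed.

Definition finitely_presented (M : lmodType R) : Prop :=
  exists a b (h : 'M[R]_(a, b)) (e : {linear 'cV[R]_a -> M}), is_presentation h e.

(** Finite presentation does not depend on the generators: it passes from [e] to the joint
    generators by [ext_presented], and from these to [e'] by [presented_ext]. *)
Lemma presented_by (M : lmodType R) (a' : nat) (e' : {linear 'cV[R]_a' -> M}) :
  finitely_presented M -> surjective e' -> exists k (h : 'M[R]_(a', k)), is_presentation h e'.
Proof.
move=> [a [b [h [e he]]]] se'; have [se _] := he.
have id_inj : injective (idfun : {linear M -> M}) by move=> ? ?.
have full k (e1 : {linear 'cV[R]_k -> M}) (v : 'cV[R]_k) :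
  range (idfun : {linear M -> M}) (e1 v) <-> exists w, v = 1%:M *m w.
  by split=> _; [exists v; rewrite mul1mx | exists (e1 v)].
have [c cE] := copair_ex e e'; have [c' c'E] := copair_ex e' e.
have [k [r rc]] : exists k (r : 'M[R]_(a + a', k)), is_presentation r c.
  apply: (ext_presented id_inj se cE (@split_relations1 R a') (full _ e')).
    by exists b, h.
  exact: copair_surj cE.
apply: (presented_ext id_inj se' c'E (@split_relations1 R a) (full _ e)).
exists k, (swap_mx a a' *m r); apply: presentation_iso rc; try exact: swap_mxK.
exact: copair_swap cE c'E.
Qed.

Lemma Fitt_finitely_presented (M : lmodType R) (a : nat) (e : {linear 'cV[R]_a -> M}) :
  finitely_presented M -> surjective e -> Fitt M = fitt_gen e.
Proof.
move=> fpM se; apply/seteqP; split=> [x [a' [b [h [e' [he' hx]]]]]|x ex].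
  have [se' _] := he'.
  by rewrite (fitt_gen_unique se se') -(presented_fitt_gen he').
have [k [h he]] := presented_by fpM se.
by exists a, k, h, e; split=> //; rewrite (presented_fitt_gen he).
Qed.

(** This case has to be covered because the module [N] at the left end is only assumed finitely
    generated. *)
Lemma Fitt_not_finitely_presented (M : lmodType R) :
  ~ finitely_presented M -> Fitt M = set0.
Proof.
move=> nfp; apply/seteqP; split=> // x [a [b [h [e [he _]]]]].
by case: nfp; exists a, b, h, e.
Qed.

Lemma Fitt_iso (M N : lmodType R) (f : {linear M -> N}) :
  injective f -> surjective f -> Fitt M = Fitt N.
Proof.
move=> injf surf.
have [x|g gK] := lin_factor_inj (f := (idfun : {linear N -> N})) injf.
  by have [y <-] := surf x; exists y.
apply/seteqP; split=> x [a [b [h [e [[se ke] hx]]]]].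
  exists a, b, h, (f \o e : {linear _ -> _}); split=> //; split=> [y|v].
    by have [z <-] := surf y; have [w <-] := se z; exists w.
  rewrite -ke /=; split=> [E|->]; last exact: linear0.
  by apply: injf; rewrite linear0.
exists a, b, h, (g \o e : {linear _ -> _}); split=> //; split=> [y|v].
  by have [w ew] := se (f y); exists w => /=; apply: injf; rewrite gK ew.
rewrite -ke /=; split=> [E|->]; last exact: linear0.
by rewrite -[e v]gK E linear0.
Qed.

(** * Torsion modules of projective dimension at most 1 *)

(** The form in which torsion over [Z_p[[T]]] enters the module theory. *)
Definition killed (M : lmodType R) : Prop :=
  exists2 f : R, GRing.lreg f & forall x : M, f *: x = 0.

Definition torsion_pd1 (P : lmodType R) : Prop :=
  [/\ finitely_generated P, killed P & pd_le 1 P].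

(** The argument of Schanuel's lemma. Comparison maps [al] and [be] between ['cV[R]_a] and [P0] make
    [kernel e] a direct summand of [K] plus ['cV[R]_a]: each [x] is [be (al x)] plus
    [x - be (al x)], and both terms lie in the kernel. *)
Lemma syzygy_projective (P : lmodType R) (a : nat) (e : {linear 'cV[R]_a -> P}) :
  pd_le 1 P -> surjective e -> is_projective (kernel e : lmodType R).
Proof.
move=> [P0 [K [i [eps [projP0 [injfi [keps [surjeps projK]]]]]]]] se.
have [al alE] := colvec_lift e surjeps.
have [be beE] := projP0 _ _ e eps se.
have [x|alK alKE] := lin_factor_inj (f := (al \o ker_incl e : {linear _ -> _})) injfi.
  by apply/keps; rewrite /= alE; apply/ker_inclP; exists x.
have [c x y|r rE] := @linear_ex R 'cV[R]_a 'cV[R]_a (fun x => x - be (al x)).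
  by rewrite !linearP /= scalerDr addrACA.
have [x|be1 be1E] := lin_factor_inj (f := (be \o i : {linear _ -> _})) (@ker_incl_inj _ _ _ e).
  by apply/ker_inclP; rewrite /= beE; apply/keps; exists x.
have [x|r1 r1E] := lin_factor_inj (f := r) (@ker_incl_inj _ _ _ e).
  by apply/ker_inclP; rewrite rE linearB /= beE alE subrr.
move=> A B f g surf.
have [h1 h1E] := projK _ _ f (g \o be1 : {linear _ -> _}) surf.
have [h2 h2E] := colvec_lift (g \o r1 : {linear _ -> _}) surf.
have [c x y|h hE] := @linear_ex R (kernel e) A (fun x => h1 (alK x) + h2 (ker_incl e x)).
  by rewrite !linearP /= scalerDr addrACA.
exists h => x; rewrite hE linearD h1E h2E /= -linearD; congr (g _).
apply: (@ker_incl_inj _ _ _ e).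
by rewrite linearD be1E r1E rE /= alKE /= addrC subrK.
Qed.

Lemma torsion_pd1_relations (P : lmodType R) (a : nat) (e : {linear 'cV[R]_a -> P}) :
  torsion_pd1 P -> surjective e -> exists b f (h : 'M[R]_(a, b)) (g : 'M[R]_(b, a)) (E : 'M[R]_b),
    split_relations f h g E /\ is_presentation h e.
Proof.
move=> [_ [f regf fP] pdP] se; set j := ker_incl e.
have injj : injective j := @ker_incl_inj _ _ _ e.
have jf v : range j (f *: v) by apply/ker_inclP; rewrite linearZ /= fP.
have [b [h [s [hj hs]]]] := dual_basis (syzygy_projective pdP se) injj regf jf.
have [c x y|fL fLE] := @linear_ex R 'cV[R]_a 'cV[R]_a (fun v => f *: v).
  by rewrite scalerDr !scalerA mulrC.
have [v|r rK] := lin_factor_inj (f := fL) injj; first by rewrite fLE.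
have [c x y|hL hLE] := @linear_ex R 'cV[R]_b 'cV[R]_a (fun w => h *m w).
  by rewrite linearP.
have [v|k kK] := lin_factor_inj (f := hL) injj; first by rewrite hLE.
have [g gE] := colvec_linear_matrix (s \o r : {linear _ -> _}).
have [E EE] := colvec_linear_matrix (s \o k : {linear _ -> _}).
exists b, f, h, g, E; split; last first.
  split=> // v; rewrite ker_inclP; split=> [[x _ <-]|[w ->]]; last exact: hj.
  by exists (s x); rewrite hs.
split=> //; apply: mulmx_ext => w.
  by rewrite -mulmxA -gE /= hs rK fLE mul_scalar_mx.
rewrite -mulmxA -gE -scalemxAl -EE /= -linearZ; congr (s _).
by apply: injj; rewrite rK fLE linearZ kK hLE.
Qed.

Lemma torsion_pd1_fp (P : lmodType R) : torsion_pd1 P -> finitely_presented P.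
Proof.
move=> gP; have [fgP _ _] := gP; have [a [e se]] := fg_surj fgP.
have [b [f [h [g [E [_ he]]]]]] := torsion_pd1_relations gP se.
by exists a, b, h, e.
Qed.

End FittingInvariance.
(** * Fractional ideals *)

Section FractionalIdeals.
Variables (R : comNzRingType) (Q : comUnitRingType) (iota : {rmorphism R -> Q}).
Implicit Types I J K L : set Q.

Definition add_closed (I : set Q) : Prop := I 0 /\ forall x y, I x -> I y -> I (x + y).

Lemma frac_mul_add I J : add_closed (frac_mul I J).
Proof.
split=> [|x y [m [u [v [Iu [Jv ->]]]]] [n [u' [v' [Iu' [Jv' ->]]]]]].
  by exists 0%N, (fun=> 0), (fun=> 0); rewrite big_ord0; split=> [[]|]; last split=> [[]|].
exists (m + n)%N, (fun k => match split k with inl k => u k | inr k => u' k end),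
  (fun k => match split k with inl k => v k | inr k => v' k end); split=> [k|].
  by case: split.
split=> [k|]; first by case: split.
by rewrite big_split_ord; congr (_ + _); apply: eq_bigr => k _;
  rewrite ?(unsplitK (inl _)) ?(unsplitK (inr _)).
Qed.

Lemma frac_mul_in I J x y : I x -> J y -> frac_mul I J (x * y).
Proof. by move=> Ix Jy; exists 1%N, (fun=> x), (fun=> y); rewrite big_ord1. Qed.

Lemma frac_mul_min I J K : add_closed K -> (forall x y, I x -> J y -> K (x * y)) ->
  frac_mul I J `<=` K.
Proof.
move=> [K0 KD] IJK _ [m [u [v [Iu [Jv ->]]]]].
by elim/big_ind: _ => // k _; apply: IJK.
Qed.

Lemma frac_mulC : commutative (@frac_mul Q).
Proof.
have H I J : frac_mul I J `<=` frac_mul J I.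
  apply: frac_mul_min => [|x y Ix Jy]; first exact: frac_mul_add.
  by rewrite mulrC; apply: frac_mul_in.
by move=> I J; apply/seteqP; split.
Qed.

Lemma frac_mulA : associative (@frac_mul Q).
Proof.
have H I J K : frac_mul I (frac_mul J K) `<=` frac_mul (frac_mul I J) K.
  apply: frac_mul_min => [|x y Ix]; first exact: frac_mul_add.
  move: y; apply: frac_mul_min => [|y z Jy Kz].
    have [F0 FD] := frac_mul_add (frac_mul I J) K.
    by split=> [|? ? ? ?]; rewrite ?mulr0 ?mulrDr //; apply: FD.
  by rewrite mulrA; apply: frac_mul_in => //; apply: frac_mul_in.
move=> I J K; apply/seteqP; split; first exact: H.
have := @H K J I.
by rewrite (frac_mulC K (frac_mul J I)) (frac_mulC J I) (frac_mulC _ I) (frac_mulC K J).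
Qed.

HB.instance Definition _ :=
  SemiGroup.isComLaw.Build (set Q) (@frac_mul Q) frac_mulA frac_mulC.

Lemma frac_mulCA I J K : frac_mul I (frac_mul J K) = frac_mul J (frac_mul I K).
Proof. by rewrite frac_mulA (frac_mulC I) -frac_mulA. Qed.

Lemma frac_mulACA I J K L :
  frac_mul (frac_mul I J) (frac_mul K L) = frac_mul (frac_mul I K) (frac_mul J L).
Proof. by rewrite -!frac_mulA (frac_mulCA J). Qed.

Lemma frac_mul_set0 I : frac_mul I set0 = [set 0].
Proof.
apply/seteqP; split=> [|_ ->]; last by case: (frac_mul_add I set0).
by apply: frac_mul_min => // ; split=> [//|x y -> ->]; rewrite addr0.
Qed.

Lemma frac_mul_0 I : frac_mul I [set 0] = [set 0].
Proof.
apply/seteqP; split=> [|_ ->]; last by case: (frac_mul_add I [set 0]).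
apply: frac_mul_min => [|x y _ ->]; last by rewrite mulr0.
by split=> [//|x y -> ->]; rewrite addr0.
Qed.

Lemma frac_one_mul (I : set R) : is_ideal I -> frac_mul (frac_one iota) (iota @` I) = iota @` I.
Proof.
move=> [I0 ID IM]; apply/seteqP; split=> [|_ [x Ix <-]].
  apply: frac_mul_min => [|_ _ [r _ <-] [x Ix <-]].
    split=> [|_ _ [x Ix <-] [y Iy <-]]; first by exists 0; rewrite ?rmorph0.
    by exists (x + y); rewrite ?rmorphD //; apply: ID.
  by exists (r * x); rewrite ?rmorphM //; apply: IM.
by rewrite -[iota x]mul1r; apply: frac_mul_in; [exists 1; rewrite ?rmorph1 | exists x].
Qed.

Lemma frac_one_idem : frac_mul (frac_one iota) (frac_one iota) = frac_one iota.
Proof. by apply: (frac_one_mul (I := setT)). Qed.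

(* If M is not finitely presented, then Fitt M is empty and this is {0}. *)
Definition Fitt_span (M : lmodType R) : set Q := frac_mul (frac_one iota) (Fitt_frac iota M).

Lemma Fitt_frac_presented (P : lmodType R) (a b : nat) (h : 'M[R]_(a, b))
    (e : {linear 'cV[R]_a -> P}) :
  is_presentation h e -> Fitt_frac iota P = iota @` minors_ideal h.
Proof.
move=> he; have [se _] := he.
rewrite /Fitt_frac (Fitt_finitely_presented (e := e)) //; last by exists a, b, h, e.
by rewrite (presented_fitt_gen he).
Qed.

Lemma Fitt_span_torsion_pd1 (P : lmodType R) : torsion_pd1 P -> Fitt_span P = Fitt_frac iota P.
Proof.
move=> /torsion_pd1_fp[a [b [h [e he]]]]; rewrite /Fitt_span (Fitt_frac_presented he).
by apply: frac_one_mul; apply: minors_ideal_is_ideal.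
Qed.

(** If [A] is finitely presented, so is [X], and the two inclusions are [fitt_ext_le] and
    [fitt_ext_ge]. Otherwise neither is, and both sides are the zero ideal. *)
Lemma Fitt_span_extension (A X P : lmodType R) (i : {linear A -> X}) (q : {linear X -> P}) :
  short_exact i q -> finitely_generated A -> torsion_pd1 P ->
  Fitt_span X = frac_mul (Fitt_frac iota P) (Fitt_span A).
Proof.
move=> [inji kq sq] fgA gP; have [fgP _ _] := gP.
have [m [eA seA]] := fg_surj fgA; have [a [eP seP]] := fg_surj fgP.
have [xt xtE] := colvec_lift eP sq.
have [b [f [h [g [E [hgE [_ kh]]]]]]] := torsion_pd1_relations gP seP.
have [eX eXE] := copair_ex (i \o eA : {linear _ -> _}) xt.
have xth v : range i (xt v) <-> exists w, v = h *m w by rewrite -kq xtE.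
have seX : surjective eX.
  move=> x; have [v qv] := seP (q x).
  have [y _ iy] : range i (x - xt v) by apply/kq; rewrite linearB /= xtE qv subrr.
  by have [u yu] := seA y; exists (col_mx u v); rewrite eXE /= yu iy subrK.
have hP : is_presentation h eP by [].
have [fpA|nfpA] := pselect (finitely_presented A).
  have fpX : finitely_presented X.
    have [k [r hr]] := ext_presented inji seA eXE hgE xth (presented_by fpA seA) seX.
    by exists (m + a)%N, k, r, eX.
  rewrite /Fitt_span frac_mulCA; congr (frac_mul _ _).
  rewrite (Fitt_frac_presented hP) /Fitt_frac.
  rewrite (Fitt_finitely_presented fpX seX) (Fitt_finitely_presented fpA seA).
  apply/seteqP; split=> [_ [x xX <-]|].
    apply: (fitt_ext_le inji seA eXE hgE xth
      (I := [set x | frac_mul (iota @` minors_ideal h) (iota @` fitt_gen eA) (iota x)])) xX.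
      have [F0 FD] := frac_mul_add (iota @` minors_ideal h) (iota @` fitt_gen eA).
      split=> [|x' y /= Fx Fy|r x' Fx] /=; rewrite ?rmorph0 ?rmorphD ?rmorphM //; first exact: FD.
      rewrite -(frac_one_mul (minors_ideal_is_ideal h)) -frac_mulA.
      by apply: frac_mul_in => //; exists r.
    move=> H eH y hy /=; rewrite mulrC rmorphM; apply: frac_mul_in; first by exists y.
    by exists (\det H) => //; apply: det_fitt_gen.
  apply: frac_mul_min => [|_ _ [y hy <-] [x xA <-]].
    have [F0 FD _] := fitt_gen_ideal eX; split=> [|_ _ [x Fx <-] [y Fy <-]].
      by exists 0; rewrite ?rmorph0.
    by exists (x + y); rewrite ?rmorphD //; apply: FD.
  exists (x * y); last by rewrite rmorphM mulrC.
  exact: (fitt_ext_ge inji seA eXE hgE xth).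
have nfpX : ~ finitely_presented X.
  move=> fpX; apply: nfpA; have [k [r hr]] := presented_ext inji seA eXE hgE xth (presented_by fpX seX).
  by exists m, k, r, eA.
rewrite /Fitt_span /Fitt_frac (Fitt_not_finitely_presented nfpX) (Fitt_not_finitely_presented nfpA).
by rewrite image_set0 !frac_mul_set0 frac_mul_0.
Qed.

Hypothesis Q_fractions : is_total_fraction_ring iota.

Lemma Fitt_frac_invertible (P : lmodType R) : torsion_pd1 P ->
  frac_mul (Fitt_frac iota P) (frac_inv iota (Fitt_frac iota P)) = frac_one iota.
Proof.
move=> gP; have [fgP _ _] := gP; have [a [e se]] := fg_surj fgP.
have [b [f [h [g [E [hgE he]]]]]] := torsion_pd1_relations gP se.
rewrite (Fitt_frac_presented he); apply/seteqP; split.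
  apply: frac_mul_min => [|x y Ix]; last by move=> /(_ _ Ix); rewrite mulrC.
  split=> [|_ _ [x _ <-] [y _ <-]]; first by exists 0; rewrite ?rmorph0.
  by exists (x + y); rewrite ?rmorphD.
have [iota_inj [unit_iota _]] := Q_fractions; have [regf hg gh] := hgE.
have uf : iota (f ^+ a) \is a GRing.unit by apply: unit_iota; apply: lregX.
have [S CB] := Cauchy_Binet R a b.
have hgf : f ^+ a = \sum_(s | S s) \det (colsub s h) * \det (rowsub s g).
  by rewrite -CB hg det_scalar.
move=> _ [r _ <-].
(* Cauchy-Binet for [h *m g = f%:M] writes [f ^+ a] as a sum of products of minors; dividing by it
   exhibits elements of the inverse ideal, as [det_minors_prod] shows below. *)
have -> : iota r = \sum_(s | S s) iota (r * \det (colsub s h)) *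
    (iota (\det (rowsub s g)) / iota (f ^+ a)).
  rewrite -[LHS]mulr1 -(divrr uf) {1}hgf rmorph_sum mulr_suml mulr_sumr.
  by apply: eq_bigr => s _; rewrite !rmorphM !mulrA.
have [F0 FD] := frac_mul_add (iota @` minors_ideal h) (frac_inv iota (iota @` minors_ideal h)).
elim/big_ind: _ => // s _; apply: frac_mul_in.
  exists (r * \det (colsub s h)) => //.
  by case: (minors_ideal_is_ideal h) => _ _; apply; apply: minor_in.
move=> _ [x hx <-]; move: x hx; apply: minors_ideal_min => [|t].
  split=> [|x y [u _ Eu] [v _ Ev]|u x [v _ Ev]]; first by exists 0; rewrite ?rmorph0 ?mulr0.
    by exists (u + v); rewrite ?rmorphD ?mulrDr ?Eu ?Ev.
  by exists (u * v); rewrite // !rmorphM [RHS]mulrCA -Ev.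
exists (\det (mxsub s t E)) => //.
rewrite mulrAC -rmorphM [_ * \det (colsub t h)]mulrC (det_minors_prod hgE) rmorphM.
by rewrite mulrAC divrr // mul1r.
Qed.

End FractionalIdeals.
(** * Exact sequences *)

Section Resolutions.
Variables (R : comNzRingType) (Q : comUnitRingType) (iota : {rmorphism R -> Q}).
Hypothesis Q_fractions : is_total_fraction_ring iota.
Implicit Types (A B C D E F M P : lmodType R) (J : set Q).

Definition fg_killed M : Prop := finitely_generated M /\ killed M.

Lemma torsion_pd1_fg_killed P : torsion_pd1 P -> fg_killed P.
Proof. by case. Qed.

Lemma fg_killed_quotient P M (q : {linear P -> M}) :
  surjective q -> fg_killed P -> fg_killed M.
Proof.
move=> sq [fgP [f regf fP]]; split; last first.
  by exists f => // x; have [y <-] := sq x; rewrite -linearZ /= fP linear0.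
have [a [e se]] := fg_surj fgP; apply: (@surj_fg _ _ a (q \o e : {linear _ -> _})).
by move=> x; have [y <-] := sq x; have [w <-] := se y; exists w.
Qed.

Lemma fg_killed_extension A E P (i : {linear A -> E}) (q : {linear E -> P}) :
  short_exact i q -> fg_killed A -> fg_killed P -> fg_killed E.
Proof.
move=> [inji kq sq] [fgA [f regf fA]] [fgP [g regg gP]]; split; last first.
  exists (f * g) => [|x]; first by move=> x y; rewrite -!mulrA => /regf/regg.
  have [y _ iy] : range i (g *: x) by apply/kq; rewrite linearZ /= gP.
  by rewrite -scalerA -iy -linearZ /= fA linear0.
have [m [eA seA]] := fg_surj fgA; have [a [eP seP]] := fg_surj fgP.
have [xt xtE] := colvec_lift eP sq.
have [eX eXE] := copair_ex (i \o eA : {linear _ -> _}) xt.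
apply: (@surj_fg _ _ _ eX) => x; have [v qv] := seP (q x).
have [y _ iy] : range i (x - xt v) by apply/kq; rewrite linearB /= xtE qv subrr.
by have [u yu] := seA y; exists (col_mx u v); rewrite eXE /= yu iy subrK.
Qed.

(** [P] is presented on the images of generators of [E]; the columns of [h], mapped to [E], then
    generate [A]. *)
Lemma fg_killed_kernel A E P (i : {linear A -> E}) (q : {linear E -> P}) :
  short_exact i q -> fg_killed E -> torsion_pd1 P -> fg_killed A.
Proof.
move=> [inji kq sq] [fgE [f regf fE]] gP; split; last first.
  by exists f => // x; apply: inji; rewrite linearZ /= fE linear0.
have [a [e se]] := fg_surj fgE.
have [|b [g [h [g' [I [_ [_ kh]]]]]]] := torsion_pd1_relations gP (e := (q \o e : {linear _ -> _})).
  by move=> x; have [y <-] := sq x; have [w <-] := se y; exists w.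
have [c x y|eh ehE] := @linear_ex R 'cV[R]_b E (fun w => e (h *m w)).
  by rewrite linearP /= linearP.
have [w|r rE] := lin_factor_inj (f := eh) inji.
  by rewrite ehE; apply/kq/kh; exists w.
apply: (@surj_fg _ _ _ r) => x; have [v ev] := se (i x).
have [w vw] : exists w, v = h *m w by apply/kh; rewrite /= ev; apply/kq; exists x.
by exists w; apply: inji; rewrite rE ehE -vw.
Qed.

(** A free cover of [C] also covers [P]. Both syzygies are projective, and the quotient of
    [kernel eP] by [kernel e] is [A]. *)
Lemma torsion_pd1_kernel A C P (i : {linear A -> C}) (q : {linear C -> P}) :
  short_exact i q -> torsion_pd1 C -> torsion_pd1 P -> torsion_pd1 A.
Proof.
move=> iq gC gP; have [fgA kA] := fg_killed_kernel iq (torsion_pd1_fg_killed gC) gP.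
split=> //; have [inji kq sq] := iq; have [fgC _ pdC] := gC; have [_ _ pdP] := gP.
have [c [e se]] := fg_surj fgC.
pose eP : {linear 'cV[R]_c -> P} := (q \o e : {linear _ -> _}).
have seP : surjective eP.
  by move=> x; have [y <-] := sq x; have [w <-] := se y; exists w.
have [x|t tE] := lin_factor_inj (f := (e \o ker_incl eP : {linear _ -> _})) inji.
  by apply/kq; apply/(ker_inclP eP); exists x.
have [x|j jE] := lin_factor_inj (f := ker_incl e) (@ker_incl_inj _ _ _ eP).
  apply/ker_inclP; rewrite /eP /=.
  have -> : e (ker_incl e x) = 0 by apply/ker_inclP; exists x.
  exact: linear0.
exists (kernel eP), (kernel e), j, t; split; first exact: syzygy_projective.
split; first by move=> x y E; apply: (@ker_incl_inj _ _ _ e); rewrite -!jE E.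
split=> [x|]; last first.
  split; last exact: syzygy_projective.
  move=> x; have [w ew] := se (i x).
  have [y _ yw] : range (ker_incl eP) w.
    by apply/ker_inclP; rewrite /eP /= ew; apply/kq; exists x.
  by exists y; apply: inji; rewrite tE -ew -yw.
split=> [tx|[y _ <-]].
  have [y _ yx] : range (ker_incl e) (ker_incl eP x).
    by apply/ker_inclP; have := tE x; rewrite tx linear0.
  by exists y => //; apply: (@ker_incl_inj _ _ _ eP); rewrite jE.
have ey : e (ker_incl e y) = 0 by apply/ker_inclP; exists y.
by apply: inji; rewrite tE linear0 -ey -jE.
Qed.

(* The cover is (R / f)^a, where f kills E. *)
Lemma torsion_pd1_cover E : fg_killed E ->
  exists (C : lmodType R) (q : {linear C -> E}), torsion_pd1 C /\ surjective q.
Proof.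
move=> [fgE [f regf fE]]; have [a [e se]] := fg_surj fgE.
have [c x y|fL fLE] := @linear_ex R 'cV[R]_a 'cV[R]_a (fun v => f *: v).
  by rewrite scalerDr !scalerA mulrC.
have [p [sp kp]] := coker_ex fL.
have ex y : exists x, p x = y by apply: sp.
pose s y := projT1 (cid (ex y)).
have sK y : p (s y) = y := projT2 (cid (ex y)).
have es x : e (s (p x)) = e x.
  have [w _ fw] : range fL (s (p x) - x) by apply/kp; rewrite linearB /= sK subrr.
  by apply/eqP; rewrite -subr_eq0 -linearB -fw fLE linearZ /= fE.
have [k x y|q qE] := @linear_ex R (coker fL) E (fun y => e (s y)).
  by rewrite -linearP -[in RHS]es linearP !sK.
exists (coker fL), q; split; last by move=> x; have [w <-] := se x; exists (p w); rewrite qE es.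
split; first exact: (surj_fg sp).
  exists f => // y; rewrite -[y]sK -linearZ; apply/kp; exists (s y) => //.
exists 'cV[R]_a, 'cV[R]_a, fL, p; split; first exact: colvec_projective.
split; first by move=> x y; rewrite !fLE; apply: scalemx_reg.
by split=> //; split=> //; apply: colvec_projective.
Qed.

(** [CA] is the preimage of [A] in the cover [C] of [E], so the restricted cover keeps the kernel
    [D]. *)
Lemma pullback_cover A E P D C (i : {linear A -> E}) (p : {linear E -> P})
    (j : {linear D -> C}) (q : {linear C -> E}) :
  short_exact i p -> short_exact j q ->
  exists (CA : lmodType R) (k : {linear CA -> C}) (pq : {linear C -> P}) (j' : {linear D -> CA})
    (q' : {linear CA -> A}), short_exact k pq /\ short_exact j' q'.
Proof.
move=> [inji kp sp] [injj kq sq].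
pose pq : {linear C -> P} := (p \o q : {linear _ -> _}).
have [x|q' qE] := lin_factor_inj (f := (q \o ker_incl pq : {linear _ -> _})) inji.
  by apply/kp; apply/(ker_inclP pq); exists x.
have [x|j' jE] := lin_factor_inj (f := j) (@ker_incl_inj _ _ _ pq).
  apply/ker_inclP; rewrite /pq /=.
  have -> : q (j x) = 0 by apply/kq; exists x.
  exact: linear0.
exists (kernel pq), (ker_incl pq), pq, j', q'; split; split.
- exact: ker_incl_inj.
- exact: ker_inclP.
- by move=> x; have [y <-] := sp x; have [z <-] := sq y; exists z.
- by move=> x y E0; apply: injj; rewrite -!jE E0.
- move=> x; split=> [qx|[y _ <-]].
    have [y _ yx] : range j (ker_incl pq x) by apply/kq; have := qE x; rewrite qx linear0.
    by exists y => //; apply: (@ker_incl_inj _ _ _ pq); rewrite jE.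
  have qy : q (j y) = 0 by apply/kq; exists y.
  by apply: inji; rewrite qE linear0 -qy -jE.
- move=> x; have [z qz] := sq (i x).
  have [y _ yz] : range (ker_incl pq) z.
    by apply/ker_inclP; rewrite /pq /= qz; apply/kp; exists x.
  by exists y; apply: inji; rewrite qE -qz -yz.
Qed.

Lemma fibre_product B P B' P' M (i : {linear B -> P}) (q : {linear P -> M})
    (i' : {linear B' -> P'}) (q' : {linear P' -> M}) :
  short_exact i q -> short_exact i' q' ->
  exists (E : lmodType R) (u : {linear B -> E}) (v : {linear E -> P'}) (u' : {linear B' -> E})
    (v' : {linear E -> P}), short_exact u v /\ short_exact u' v'.
Proof.
move=> [inji kq sq] [inji' kq' sq'].
have [c x y|d dE] := @linear_ex R (P * P')%type M (fun z => q z.1 - q' z.2).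
  by rewrite /= !linearP /= scalerDr addrACA.
have [c x y|i1 i1E] := @linear_ex R B (P * P')%type (fun b => (i b, 0)).
  by congr pair; rewrite ?linearP //= scaler0 addr0.
have [c x y|i2 i2E] := @linear_ex R B' (P * P')%type (fun b => (0, i' b)).
  by congr pair; rewrite ?linearP //= scaler0 addr0.
have [x|u uE] := lin_factor_inj (f := i1) (@ker_incl_inj _ _ _ d).
  by apply/ker_inclP; rewrite dE i1E /= linear0 subr0; apply/kq; exists x.
have [x|u' uE'] := lin_factor_inj (f := i2) (@ker_incl_inj _ _ _ d).
  apply/ker_inclP; rewrite dE i2E /= linear0 sub0r.
  have -> : q' (i' x) = 0 by apply/kq'; exists x.
  exact: oppr0.
have kd z : d (ker_incl d z) = 0 by apply/ker_inclP; exists z.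
exists (kernel d), u, (snd \o ker_incl d : {linear _ -> _}), u', (fst \o ker_incl d : {linear _ -> _}).
split; split.
- move=> x y E0; apply: inji; have := uE x; rewrite E0 uE !i1E.
  by case.
- move=> x; split=> [x2|[y _ <-]]; last by rewrite -[LHS]/((ker_incl d (u y)).2) uE i1E.
  have {}x2 : (ker_incl d x).2 = 0 := x2.
  have [y _ yx] : range i (ker_incl d x).1.
    by apply/kq; have := kd x; rewrite dE x2 linear0 subr0.
  exists y => //; apply: (@ker_incl_inj _ _ _ d); rewrite uE i1E yx -x2.
  by case: (ker_incl d x).
- move=> y; have [x qx] := sq (q' y).
  have [z _ zE] : range (ker_incl d) (x, y) by apply/ker_inclP; rewrite dE /= qx subrr.
  by exists z; rewrite -[RHS]/((x, y).2) -zE.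
- move=> x y E0; apply: inji'; have := uE' x; rewrite E0 uE' !i2E.
  by case.
- move=> x; split=> [x1|[y _ <-]]; last by rewrite -[LHS]/((ker_incl d (u' y)).1) uE' i2E.
  have {}x1 : (ker_incl d x).1 = 0 := x1.
  have [y _ yx] : range i' (ker_incl d x).2.
    apply/kq'; have := kd x; rewrite dE x1 linear0 sub0r => /eqP.
    by rewrite oppr_eq0 => /eqP.
  exists y => //; apply: (@ker_incl_inj _ _ _ d); rewrite uE' i2E yx -x1.
  by case: (ker_incl d x).
- move=> y; have [x qx] := sq' (q y).
  have [z _ zE] : range (ker_incl d) (y, x) by apply/ker_inclP; rewrite dE /= qx subrr.
  by exists z; rewrite -[RHS]/((y, x).1) -zE.
Qed.

(** * Signed Fitting ideals and the invariant of a sequence *)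

(** The Fitting ideal of [P] raised to the power [(-1)^n]. *)
Definition Fitt_sign (n : nat) P : set Q :=
  if odd n then frac_inv iota (Fitt_frac iota P) else Fitt_frac iota P.

Lemma Fitt_signK n P : torsion_pd1 P -> frac_mul (Fitt_sign n P) (Fitt_sign n.+1 P) = frac_one iota.
Proof.
move=> gP; rewrite /Fitt_sign /=; case: odd => /=; last exact: Fitt_frac_invertible.
by rewrite frac_mulC; apply: Fitt_frac_invertible.
Qed.

Lemma frac_one_Fitt_span M : frac_mul (frac_one iota) (Fitt_span iota M) = Fitt_span iota M.
Proof. by rewrite /Fitt_span frac_mulA frac_one_idem. Qed.

Lemma frac_one_Fitt_sign n P : torsion_pd1 P ->
  frac_mul (frac_one iota) (Fitt_sign n P) = Fitt_sign n P.
Proof.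
move=> gP; rewrite /Fitt_sign; case: odd; last by rewrite -Fitt_span_torsion_pd1 // frac_one_Fitt_span.
apply/seteqP; split=> [|x Px]; last first.
  by rewrite -[x]mul1r; apply: frac_mul_in => //; exists 1; rewrite ?rmorph1.
have F1 : frac_mul (frac_one iota) (frac_one iota) `<=` frac_one iota by rewrite frac_one_idem.
apply: frac_mul_min => [|x y Rx Py z Pz]; last first.
  by rewrite -mulrA; apply: F1; apply: frac_mul_in => //; apply: Py.
split=> [x _|x y Px Py z Pz]; first by rewrite mul0r; exists 0; rewrite ?rmorph0.
have [u _ Eu] := Px z Pz; have [v _ Ev] := Py z Pz.
by exists (u + v); rewrite // rmorphD mulrDl Eu Ev.
Qed.

(** Even exponents are [Fitt_span_extension]. Odd exponents follow by cancelling the even case for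
    [n.+1], through [Fitt_signK]. *)
Lemma Fitt_sign_extension n A C P (i : {linear A -> C}) (q : {linear C -> P}) :
  short_exact i q -> torsion_pd1 A -> torsion_pd1 C -> torsion_pd1 P ->
  Fitt_sign n C = frac_mul (Fitt_sign n A) (Fitt_sign n P).
Proof.
move=> iq gA gC gP; have [fgA _ _] := gA.
have E0 m : ~~ odd m -> Fitt_sign m C = frac_mul (Fitt_sign m A) (Fitt_sign m P).
  move=> /negPf om; rewrite /Fitt_sign om -(Fitt_span_torsion_pd1 iota gC) (Fitt_span_extension iota iq fgA gP).
  by rewrite Fitt_span_torsion_pd1 // frac_mulC.
case on: (odd n); last by apply: E0; rewrite on.
have {}E0 : Fitt_sign n.+1 C = frac_mul (Fitt_sign n.+1 A) (Fitt_sign n.+1 P).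
  by apply: E0; rewrite /= on.
transitivity (frac_mul (frac_mul (Fitt_sign n A) (Fitt_sign n P))
    (frac_mul (Fitt_sign n C) (Fitt_sign n.+1 C))); last first.
  by rewrite Fitt_signK // frac_mulC frac_mulA frac_one_Fitt_sign.
rewrite E0 (frac_mulC (Fitt_sign n C)) frac_mulA frac_mulACA !Fitt_signK //.
by rewrite frac_one_idem frac_one_Fitt_sign.
Qed.

(* J is the shifted Fitting ideal of some sequence of length n ending in M. *)
Fixpoint shifted_Fitt_value (n : nat) (M : lmodType R) (J : set Q) : Prop :=
  if n is n'.+1 then exists (B P : lmodType R) (i : {linear B -> P}) (q : {linear P -> M}) J',
    [/\ short_exact i q, torsion_pd1 P, shifted_Fitt_value n' B J' &
      J = frac_mul (Fitt_sign n P) J']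
  else fg_killed M /\ J = Fitt_span iota M.

Lemma shifted_Fitt_value_fg_killed n M J : shifted_Fitt_value n M J -> fg_killed M.
Proof.
case: n => [[]//|n [B [P [i [q [J' [[_ _ sq] gP _ _]]]]]]].
by apply: (fg_killed_quotient sq); apply: torsion_pd1_fg_killed.
Qed.

Lemma frac_one_shifted_Fitt_value n M J : shifted_Fitt_value n M J ->
  frac_mul (frac_one iota) J = J.
Proof.
case: n => [[_ ->]|n [B [P [i [q [J' [_ gP _ ->]]]]]]]; first exact: frac_one_Fitt_span.
by rewrite frac_mulA frac_one_Fitt_sign.
Qed.

(** In positive length, the last cover [C] of [E] is restricted to [A]: [B] is unchanged and [CA]
    replaces [C], which divides the value by [Fitt_sign n P] in length [n]. Length 0 is
    [Fitt_span_extension] solved for [A]. *)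
Lemma shifted_Fitt_value_kernel n A E P (i : {linear A -> E}) (q : {linear E -> P}) J :
  short_exact i q -> torsion_pd1 P -> shifted_Fitt_value n E J ->
  shifted_Fitt_value n A (frac_mul (Fitt_sign n.+1 P) J).
Proof.
move=> iq gP; case: n => [[fkE ->]|n [B [C [j [r [J' [jr gC resB ->]]]]]]].
  have fkA := fg_killed_kernel iq fkE gP; split=> //; have [fgA _] := fkA.
  rewrite (Fitt_span_extension iota iq fgA gP) frac_mulA frac_mulC.
  have := Fitt_signK 0 gP; rewrite frac_mulC {2}/Fitt_sign /= => ->.
  by rewrite frac_mulC frac_one_Fitt_span.
have [CA [k [pq [j' [r' [kpq jr']]]]]] := pullback_cover iq jr.
have gCA := torsion_pd1_kernel kpq gC gP.
exists B, CA, j', r', J'; split=> //.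
rewrite (Fitt_sign_extension n.+1 kpq gCA gC gP) frac_mulA; congr (frac_mul _ _).
by rewrite frac_mulCA [frac_mul (Fitt_sign n.+2 P) _]frac_mulC Fitt_signK // frac_mulC
  frac_one_Fitt_sign.
Qed.

Lemma shifted_Fitt_value_extension n A E P (i : {linear A -> E}) (q : {linear E -> P}) J :
  short_exact i q -> torsion_pd1 P -> shifted_Fitt_value n A J ->
  shifted_Fitt_value n E (frac_mul (Fitt_sign n P) J).
Proof.
elim: n A E P i q J => [|n IHn] A E P i q J iq gP.
  move=> [fkA ->]; split; first exact: fg_killed_extension iq fkA (torsion_pd1_fg_killed gP).
  by rewrite /Fitt_sign /= (Fitt_span_extension iota iq) //; case: fkA.
move=> resA; have fkA := shifted_Fitt_value_fg_killed resA.
case: resA => B [PA [j [r [J' [jr gPA resB ->]]]]].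
have [C [s [gC ss]]] := torsion_pd1_cover (fg_killed_extension iq fkA (torsion_pd1_fg_killed gP)).
have ks : short_exact (ker_incl s) s.
  by split=> //; [apply: ker_incl_inj | apply: ker_inclP].
have [CA [k [pq [j' [r' [kpq jr']]]]]] := pullback_cover iq ks.
have gCA := torsion_pd1_kernel kpq gC gP.
(* [F] is an extension of [CA] by [B], so the induction hypothesis gives it a value of length [n].
   It is also an extension of [PA] by [kernel s], so the value passes on to [kernel s]. *)
have [F [u [v [u' [v' [uv uv']]]]]] := fibre_product jr' jr.
have resF := IHn _ _ _ _ _ _ uv' gCA resB.
have resD := shifted_Fitt_value_kernel uv gPA resF.
exists (kernel s), C, (ker_incl s), s, (frac_mul (Fitt_sign n.+1 PA) (frac_mul (Fitt_sign n CA) J')).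
split=> //; rewrite (Fitt_sign_extension n.+1 kpq gCA gC gP).
(* [J'] is padded with the two opposite powers of the Fitting ideal of [CA], to match the factors of
   [CA] on the right. *)
rewrite -[in LHS](frac_one_shifted_Fitt_value resB) -(Fitt_signK n gCA) -!frac_mulA.
rewrite (frac_mulCA (Fitt_sign n.+1 CA)); congr (frac_mul _ _).
rewrite (frac_mulCA (Fitt_sign n.+1 CA)); congr (frac_mul _ _).
by rewrite frac_mulCA.
Qed.

Lemma shifted_Fitt_value_unique n M J J' :
  shifted_Fitt_value n M J -> shifted_Fitt_value n M J' -> J = J'.
Proof.
elim: n M J J' => [|n IHn] M J J'; first by case=> _ -> [].
move=> [B [P [i [q [J1 [iq gP resB ->]]]]]] [B' [P' [i' [q' [J2 [iq' gP' resB' ->]]]]]].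
have [E [u [v [u' [v' [uv uv']]]]]] := fibre_product iq iq'.
(* The two values of [E] agree; multiplying both by the [n.+1] powers for [P] and [P'] gives the
   claim. *)
have E0 := IHn _ _ _ (shifted_Fitt_value_extension uv gP' resB) (shifted_Fitt_value_extension uv' gP resB').
rewrite -(frac_one_shifted_Fitt_value resB) -(frac_one_shifted_Fitt_value resB').
rewrite -{1}(Fitt_signK n gP') -(Fitt_signK n gP).
rewrite [frac_mul (Fitt_sign n P') _]frac_mulC [frac_mul (Fitt_sign n P) _]frac_mulC.
by rewrite -!frac_mulA E0 frac_mulCA.
Qed.

Lemma shifted_FittS M M' n (X : exact_sequence M n.+1) (X' : exact_sequence M' n) :
  (forall i, es_mod X' i = es_mod X i) ->
  shifted_Fitt iota X = frac_mul (Fitt_sign n.+1 (X n.+1)) (shifted_Fitt iota X').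
Proof.
move=> XX'; rewrite /shifted_Fitt XX' frac_mulA; congr (frac_mul _ _).
under [in RHS]eq_bigr => i _ do rewrite XX'.
have -> : index_iota 1 n.+2 = index_iota 1 n.+1 ++ [:: n.+1].
  by rewrite /index_iota !subSS !subn0 -[in LHS](addn1 n) iotaD add1n.
(* [frac_one iota] is not neutral for arbitrary subsets of [Q], so the last factor is moved out by
   hand. *)
elim: (index_iota 1 n.+1) => [|i s IHs] /=; first by rewrite big_cons !big_nil.
by rewrite !big_cons IHs frac_mulCA.
Qed.

(** Induction by cutting the sequence at the kernel of the augmentation, which becomes the end of a
    sequence of length [n]. *)
Lemma shifted_Fitt_valueP n M (X : exact_sequence M n) :
  (forall i, (i <= n)%N -> fg_killed (X i)) ->
  (forall i, (1 <= i <= n)%N -> pd_le 1 (X i)) -> shifted_Fitt_value n M (shifted_Fitt iota X).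
Proof.
elim: n M X => [|n IHn] M X fkX pdX.
  have [inje sure] := es_exact X.
  split; first exact: fg_killed_quotient sure (fkX _ _).
  rewrite /shifted_Fitt big_geq // /Fitt_span /Fitt_frac.
  by rewrite (Fitt_iso inje sure).
have [injd exd exe sure] : [/\ injective (es_map X 0),
  forall i, (i < n)%N -> forall x, es_map X i.+1 x = 0 <-> range (es_map X i) x,
  forall x, es_aug X x = 0 <-> range (es_map X n) x & surjective (es_aug X)].
  by have [? [? []]] := es_exact X.
have [x|e eE] := lin_factor_inj (f := es_map X n) (@ker_incl_inj _ _ _ (es_aug X)).
  by apply/ker_inclP/exe; exists x.
have ex : is_exact (es_map X) e.
  have sure' : surjective e.
    move=> x; have [y _ yx] : range (es_map X n) (ker_incl _ x).
      by apply/exe/ker_inclP; exists x.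
    by exists y; apply: ker_incl_inj; rewrite eE.
  have e0 x : e x = 0 <-> es_map X n x = 0.
    split=> [ex|dx]; first by rewrite -eE ex linear0.
    by apply: ker_incl_inj; rewrite eE dx linear0.
  (* For [n = 0] exactness of the shortened sequence means that [e] is bijective; injectivity comes
     from that of the first map. *)
  move: e sure' eE e0 injd exd; clear; case: n X => [|n] X e sure' eE e0 injd exd.
    by split=> // x y exy; apply: injd; rewrite -!eE exy.
  split=> //; split=> [i lti|]; first by apply: exd; apply: ltnW.
  by split=> // x; rewrite e0; apply: exd.
pose X' := ExactSequence ex.
have gX : torsion_pd1 (X n.+1).
  by have [fg k] := fkX n.+1 (leqnn _); split=> //; apply: pdX; rewrite /= ltnSn.
exists (kernel (es_aug X)), (X n.+1), (ker_incl _), (es_aug X), (shifted_Fitt iota X').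
split=> //; first by split=> //; [apply: ker_incl_inj | apply: ker_inclP].
  apply: IHn => i; first by move=> lei; apply: fkX; apply: leqW.
  by move=> /andP[i1 lei]; apply: pdX; rewrite i1 leqW.
exact: shifted_FittS.
Qed.

End Resolutions.
(** * Divisibility by p *)

Section PadicDivisibility.
Variable p : nat.
Hypothesis p_prime : prime p.
Implicit Types a b c : Zp_int p.

Definition dvdp (k : nat) (a : Zp_int p) : Prop := exists b, a = b *+ p ^ k.

Lemma zresD a b n : zres (a + b) n = zres a n + zres b n. Proof. by []. Qed.
Lemma zres1 n : zres (1 : Zp_int p) n = 1. Proof. by []. Qed.

Lemma zresMn a m n : zres (a *+ m) n = zres a n *+ m.
Proof. by elim: m => // m IHm; rewrite !mulrS zresD IHm. Qed.

Lemma p_exp_gt1 n : (1 < p ^ n.+1)%N.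
Proof. by rewrite -(expn0 p) ltn_exp2l ?prime_gt1. Qed.

Lemma val_natr_Zpn n m : (m%:R : 'Z_(p ^ n.+1)) = (m %% p ^ n.+1)%N :> nat.
Proof. by rewrite val_Zp_nat ?p_exp_gt1. Qed.

Lemma natr_Zpn_eq0 n m : (m%:R = 0 :> 'Z_(p ^ n.+1)) <-> (p ^ n.+1 %| m)%N.
Proof.
split=> [/(congr1 (fun x : 'Z_(p ^ n.+1) => val x))|dm]; first by rewrite /= val_natr_Zpn /dvdn => ->.
by apply: val_inj; rewrite /= val_natr_Zpn; apply/eqP.
Qed.

Lemma zres_lt a n : (zres a n < p ^ n.+1)%N.
Proof. by have := ltn_ord (zres a n); rewrite [X in (_ < X)%N -> _]Zp_cast ?p_exp_gt1. Qed.

Lemma zres_mod a n : (zres a n = zres a n.+1 %% p ^ n.+1 :> nat)%N.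
Proof. by rewrite -{1}(zres_compat a n) val_natr_Zpn. Qed.

(** The component of index [n.+1] of [a *+ p] determines the component of index [n] of [a]. *)
Lemma mulrn_p_inj a : a *+ p = 0 -> a = 0.
Proof.
move=> ap; apply: Zp_int_eq => n; rewrite -(zres_compat a n).
apply/natr_Zpn_eq0; have := congr1 (fun x => zres x n.+1) ap.
rewrite zresMn -{1}[zres a n.+1]natr_Zp -mulrnA => /natr_Zpn_eq0.
by move: (nat_of_ord _) => m; rewrite [(p ^ n.+2)%N]expnSr dvdn_pmul2r // prime_gt0.
Qed.

Lemma mulrn_pX_inj k a b : a *+ p ^ k = b *+ p ^ k -> a = b.
Proof.
move=> /eqP; rewrite -subr_eq0 -mulrnBl => E; apply/eqP; rewrite -subr_eq0; move: (a - b) E.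
by elim: k => // k IHk c; rewrite expnSr mulrnA => /eqP/mulrn_p_inj/eqP/IHk.
Qed.

Lemma mulrn_pX_dvdp k a : dvdp k.+1 (a *+ p ^ k) -> dvdp 1 a.
Proof.
move=> [b E]; exists b; apply: (@mulrn_pX_inj k).
by rewrite E -mulrnA expn1 expnS.
Qed.

Lemma zres_eq0_dvdp a : zres a 0 = 0 -> dvdp 1 a.
Proof.
(* Division by [p] costs one level: the quotient modulo [p ^ n.+1] is read off [a] modulo
   [p ^ n.+2]. *)
move=> a0; pose b n : 'Z_(p ^ n.+1) := (zres a n.+1 %/ p)%:R.
have p0 := prime_gt0 p_prime.
have bc n : (b n.+1 : nat)%:R = b n.
  rewrite /b val_natr_Zpn.
  rewrite [in RHS]zres_mod; set x := (zres a n.+2 : nat).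
  have -> : ((x %/ p) %% p ^ n.+2)%N%:R = (x %/ p)%:R :> 'Z_(p ^ n.+1).
    by apply: val_inj; rewrite /= !val_natr_Zpn modn_dvdm // dvdn_exp2l.
  rewrite {1}(divn_eq x (p ^ n.+2)) [X in (_ * X + _)%N]expnSr mulnA divnMDl //.
  apply: val_inj; rewrite /= !val_natr_Zpn.
  by rewrite modnMDl.
exists (ZpInt bc); apply: Zp_int_eq => n; rewrite zresMn expn1 /= /b -mulrnA.
have dp m : (p %| zres a m)%N.
  elim: m => [|m]; first by rewrite a0 dvdn0.
  by rewrite zres_mod /dvdn modn_dvdm // dvdn_exp.
by rewrite divnK // zres_compat.
Qed.

Lemma p_decomp a : exists (j : nat) b, (j < p)%N /\ a = j%:R + b *+ p.
Proof.
have [|b ab] := @zres_eq0_dvdp (a - (zres a 0 : nat)%:R); last first.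
  have {}ab : a - (zres a 0 : nat)%:R = b *+ p := ab.
  by exists (zres a 0 : nat), b; split; [exact: zres_lt | rewrite -ab addrC subrK].
rewrite zresD; have -> c : zres (- c) 0 = - zres c 0 by [].
by rewrite zresMn zres1 natr_Zp subrr.
Qed.

Lemma Zp_decomp k a : exists (j : nat) b, (j < p ^ k)%N /\ a = j%:R + b *+ p ^ k.
Proof.
elim: k => [|k [j [b [jk ->]]]]; first by exists 0%N, a; rewrite add0r.
have [i [c [ip ->]]] := p_decomp b; exists (j + i * p ^ k)%N, c; split.
  rewrite expnS (leq_trans (n := (p ^ k + i * p ^ k)%N)) ?ltn_add2r //.
  by rewrite -mulSn leq_mul2r ip orbT.
by rewrite mulrnDl natrD addrA -!mulrnA expnS.
Qed.

Lemma dvdp_all_eq0 a : (forall k, dvdp k a) -> a = 0.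
Proof.
move=> da; apply: Zp_int_eq => n; have [b ->] := da n.+1.
rewrite zresMn -mulr_natr (natr_Zpn_eq0 n _).2 ?mulr0 //.
Qed.

Lemma inverse_mod_p a : ~ dvdp 1 a -> exists b c, b * a = 1 + c *+ p.
Proof.
move=> nda; have [j [c [_ ac]]] := p_decomp a.
have cop : coprime j p.
  rewrite coprime_sym prime_coprime //; apply/negP => dj; apply: nda; exists (c + (j %/ p)%N%:R).
  by rewrite expn1 mulrnDl addrC -mulrnA divnK.
have j0 : (0 < j)%N.
  by case: (posnP j) cop => // ->; rewrite /coprime gcd0n => /eqP p1; move: p_prime; rewrite p1.
have /coprimeP : coprime j p := cop; case/(_ j0) => [[b d] /= E].
exists b%:R, (b%:R * c + d%:R); rewrite ac mulrDr -natrM.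
have -> : (b * j = 1 + d * p)%N by rewrite -[in RHS]E subnK // ltnW // -subn_gt0 E.
by rewrite natrD natrM mulr_natr mulrnAr mulrnDl -addrA [X in _ + X]addrC.
Qed.

Lemma natr_Zp_inj_mod (i j : nat) b : (i < p)%N -> (j < p)%N -> i%:R = j%:R + b *+ p -> i = j.
Proof.
move=> ip jp /(congr1 (fun c => zres c 0)); rewrite zresD !zresMn zres1.
have p0 : p%:R = 0 :> 'Z_(p ^ 1) by apply/natr_Zpn_eq0; rewrite expn1.
rewrite -[in X in _ + X]mulr_natr p0 mulr0 addr0 => /(congr1 (fun x : 'Z_(p ^ 1) => val x)).
by rewrite /= !val_natr_Zpn expn1 !modn_small.
Qed.

Lemma dvdpD k a b : dvdp k a -> dvdp k b -> dvdp k (a + b).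
Proof. by move=> [c ->] [d ->]; exists (c + d); rewrite mulrnDl. Qed.

Lemma dvdpM k a b : dvdp k b -> dvdp k (a * b).
Proof. by move=> [c ->]; exists (a * c); rewrite mulrnAr. Qed.

Lemma dvdp0 k : dvdp k 0.
Proof. by exists 0; rewrite mul0rn. Qed.

Lemma dvdp_sum k (T : Type) (r : seq T) (P : pred T) (E : T -> Zp_int p) :
  (forall i, P i -> dvdp k (E i)) -> dvdp k (\sum_(i <- r | P i) E i).
Proof. by move=> dE; elim/big_ind: _ => //; [apply: dvdp0 | apply: dvdpD]. Qed.

End PadicDivisibility.
(** * Power series in gamma - 1 are regular *)

Section PowerSeriesValues.
Variables (p : nat) (F : set algC) (G : zmodType) (act : G -> algC -> algC).
Hypotheses (p_prime : prime p) (p_odd : odd p).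
Local Notation R := (completed_group_ring p F act).
Implicit Types (x y z : R) (g h : G).

Lemma cgr_coefD x y U g : cgr_coef (x + y) U g = cgr_coef x U g + cgr_coef y U g.
Proof. by []. Qed.
Lemma cgr_coefN x U g : cgr_coef (- x) U g = - cgr_coef x U g.
Proof. by []. Qed.
Lemma cgr_coefM x y U g :
  cgr_coef (x * y) U g = \sum_(h <- transversal U) cgr_coef x U h * cgr_coef y U (g - h).
Proof. by []. Qed.
Lemma cgr_coefMn x m U g : cgr_coef (x *+ m) U g = cgr_coef x U g *+ m.
Proof. by elim: m => // m IHm; rewrite !mulrS cgr_coefD IHm. Qed.

Lemma cgr_coef_sum (T : Type) (r : seq T) (P : pred T) (E : T -> R) U g :
  cgr_coef (\sum_(i <- r | P i) E i) U g = \sum_(i <- r | P i) cgr_coef (E i) U g.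
Proof. by elim/big_rec2: _ => // i y1 y2 _ <-. Qed.

Lemma group_element_mulE h y U g :
  cgr_coef (group_element p F act h * y) U g = cgr_coef y U (g - h).
Proof.
rewrite cgr_coefM.
transitivity (\sum_(k <- transversal U | `[< osub U (h - k) >]) cgr_coef y U (g - k)).
  rewrite [RHS]big_mkcond; apply: eq_bigr => k _ /=.
  by rewrite asbool_subC; case: asboolP => _; rewrite ?mul1r ?mul0r.
rewrite (@coset_sum_delta _ U _ _ _ h (fun k => cgr_coef y U (g - k))) //.
- exact: osub_subgroup.
- exact: osub_fin.
- by move=> k l Ul; rewrite cgr_periodicB.
Qed.

Lemma group_elementX g m : group_element p F act g ^+ m = group_element p F act (g *+ m).
Proof.
elim: m => [|m IHm]; first by rewrite expr0 mulr0n.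
apply: cgr_eq => U h; rewrite exprS group_element_mulE IHm mulrS /=.
by rewrite opprD addrA.
Qed.

Lemma cgr_scale_subproof (a : Zp_int p) x (U V : open_subgroup F act) : U `<=` V -> forall g,
  a * cgr_coef x V g = \sum_(h <- transversal U | `[< osub V (g - h) >]) a * cgr_coef x U h.
Proof. by move=> UV g; rewrite (cgr_compat x UV) mulr_sumr. Qed.

Lemma cgr_scale_periodic (a : Zp_int p) x (U : open_subgroup F act) g h : osub U h ->
  a * cgr_coef x U (g + h) = a * cgr_coef x U g.
Proof. by move=> Uh; rewrite cgr_periodic. Qed.

Definition cgr_scalar (a : Zp_int p) : R :=
  CompletedGroupRing (cgr_scale_periodic a 1) (cgr_scale_subproof a 1).

Lemma cgr_scalarE a y U g : cgr_coef (cgr_scalar a * y) U g = a * cgr_coef y U g.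
Proof.
rewrite cgr_coefM -{2}[y]mul1r cgr_coefM mulr_sumr.
by apply: eq_bigr => h _; rewrite mulrA.
Qed.

(** Vanishing modulo [p] in the single group ring of the quotient of [G] by [U]. *)
Definition dvdU (U : open_subgroup F act) y : Prop := forall g, dvdp 1 (cgr_coef y U g).

Lemma dvdUD U x y : dvdU U x -> dvdU U y -> dvdU U (x + y).
Proof. by move=> dx dy g; apply: dvdpD. Qed.
Lemma dvdUM U x y : dvdU U y -> dvdU U (x * y).
Proof. by move=> dy g; apply: dvdp_sum => h _; apply: dvdpM. Qed.
Lemma dvdUN U x : dvdU U x -> dvdU U (- x).
Proof. by rewrite -mulN1r; apply: dvdUM. Qed.
Lemma dvdUMp U x : dvdU U (x *+ p).
Proof. by move=> g; rewrite cgr_coefMn; exists (cgr_coef x U g). Qed.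
Lemma dvdU0 U : dvdU U 0.
Proof. by move=> g; exists 0; rewrite mul0rn. Qed.
Lemma dvdU_sum U (T : Type) (r : seq T) (P : pred T) (E : T -> R) :
  (forall i, P i -> dvdU U (E i)) -> dvdU U (\sum_(i <- r | P i) E i).
Proof. by move=> dE; elim/big_ind: _ => //; [apply: dvdU0 | apply: dvdUD]. Qed.

Lemma exprDp (A : comNzRingType) (x y : A) : exists z : A, (x + y) ^+ p = x ^+ p + y ^+ p + z *+ p.
Proof.
have p0 := prime_gt0 p_prime.
exists (\sum_(1 <= i < p) x ^+ (p - i) * y ^+ i *+ ('C(p, i) %/ p)).
rewrite exprDn -(big_mkord xpredT (fun i => x ^+ (p - i) * y ^+ i *+ 'C(p, i))).
rewrite big_nat_recr //= big_ltn //= subn0 subnn expr0 bin0 binn mulr1 mul1r !mulr1n.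
rewrite -addrA [X in _ + X]addrC -addrA; congr (_ + (_ + _)); rewrite -sumrMnl.
apply: eq_big_nat => i /andP[i0 ip].
by rewrite -mulrnA divnK // prime_dvd_bin // i0.
Qed.

Lemma exprBp (A : comNzRingType) (x : A) k :
  exists z : A, (x - 1) ^+ (p ^ k) = x ^+ (p ^ k) - 1 + z *+ p.
Proof.
elim: k => [|k [z E]]; first by exists 0; rewrite !expr1 mul0rn addr0.
have [z1 E1] := exprDp (x ^+ (p ^ k) - 1) (z *+ p).
have [z2 E2] := exprDp (x ^+ (p ^ k)) (-1).
exists (z2 + (z ^+ p) *+ (p ^ p.-1) + z1).
rewrite expnSr exprM E E1 E2 -exprM !mulrnDl -!addrA; congr (_ + _).
(* Here oddness of [p] gives [(-1) ^+ p = -1]. *)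
rewrite -signr_odd p_odd expr1; congr (_ + (_ + (_ + _))).
by rewrite exprMn_n -mulrnA -expnSr prednK // prime_gt0.
Qed.

(** [p ^ m] is the content of the series and [l] the Weierstrass degree of what remains. *)
Lemma Zp_series_p_part (f : nat -> Zp_int p) : (exists i, f i != 0) ->
  exists m (f' : nat -> Zp_int p) l, [/\ forall i, f i = f' i *+ p ^ m,
    forall i, (i < l)%N -> dvdp 1 (f' i) & ~ dvdp 1 (f' l)].
Proof.
move=> [i0 /eqP fi0].
have ex : exists m, `[< exists i, ~ dvdp m (f i) >].
  apply: contrapT => /forallNP nex; apply: fi0; apply: (dvdp_all_eq0 p_prime) => k.
  by apply: contrapT => nd; apply: (nex k); apply/asboolP; exists i0.
case: (ex_minnP ex) => m /asboolP[i1 ndi] minm.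
(* The least exponent at which divisibility fails is positive; its predecessor is the exponent of
   the content. *)
case: m ndi minm => [|m] ndi minm; first by case: ndi; exists (f i1).
have dvdm i : dvdp m (f i).
  apply: contrapT => nd; have /minm : `[< exists i, ~ dvdp m (f i) >] by apply/asboolP; exists i.
  by rewrite ltnn.
pose f' i := projT1 (cid (dvdm i)).
have f'E i : f i = f' i *+ p ^ m := projT2 (cid (dvdm i)).
have ex' : exists l, `[< ~ dvdp 1 (f' l) >].
  exists i1; apply/asboolP => -[b bE]; apply: ndi; exists b.
  by rewrite f'E bE expn1 -mulrnA -expnS.
case: (ex_minnP ex') => l /asboolP ndl minl; exists m, f', l; split=> // i il.
by apply: contrapT => nd; have := minl i (introT (asboolP _) nd); rewrite leqNgt il.
Qed.

(** * The levels [u (p^n Z_p)], and [T] modulo [p] at each of them *)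

Variables (u : Zp_int p -> G) (Un : nat -> open_subgroup F act).
Hypothesis uD : forall a b, u (a + b) = u a + u b.
Hypothesis UnE : forall n g, osub (Un n) g <-> exists a, g = u (a *+ p ^ n).
Hypothesis Un_small : forall U : open_subgroup F act, exists n, Un n `<=` U.
Local Notation gamma := (u 1).
Local Notation T := (group_element p F act gamma - 1).

Lemma u0 : u 0 = 0.
Proof. by apply: (addrI (u 0)); rewrite -uD !addr0. Qed.
Lemma uN a : u (- a) = - u a.
Proof. by apply: (addrI (u a)); rewrite -uD !subrr u0. Qed.
Lemma uMn a m : u (a *+ m) = u a *+ m.
Proof. by elim: m => [|m IHm]; rewrite ?mulr0n ?u0 // !mulrS uD IHm. Qed.

Lemma Un_decreasing m n : (m <= n)%N -> Un n `<=` Un m.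
Proof.
move=> mn g /UnE[a ->]; apply/UnE; exists (a *+ p ^ (n - m)).
by rewrite -mulrnA -expnD subnK.
Qed.

Lemma T_exp k : exists z, T ^+ (p ^ k) = group_element p F act (gamma *+ p ^ k) - 1 + z *+ p.
Proof.
by have [z ->] := exprBp (group_element p F act gamma) k;
  rewrite group_elementX; exists z.
Qed.

(** Modulo [p], this power of [T] is [gamma] to the power [p ^ n], minus 1, and that power of
    [gamma] lies in [Un n]. *)
Lemma dvdU_T_exp n : dvdU (Un n) (T ^+ (p ^ n)).
Proof.
have [z ->] := T_exp n; apply: dvdUD; last exact: dvdUMp.
move=> g; rewrite cgr_coefD cgr_coefN -[group_element _ _ _ _]mulr1 group_element_mulE.
rewrite cgr_periodic ?subrr; first exact: dvdp0.
rewrite -uMn -uN; apply/UnE; exists (-1); by rewrite mulNrn.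
Qed.

(* T is nilpotent modulo p at the level U, so 1 + T v is a unit there. *)
Lemma dvdU_unit_factor U v z m : dvdU U (T ^+ m) -> dvdU U ((1 + T * v) * z) -> dvdU U z.
Proof.
move=> dT dz.
have H k : dvdU U (z - (- (T * v)) ^+ k * z).
  elim: k => [|k IHk]; first by rewrite expr0 mul1r subrr; apply: dvdU0.
  rewrite exprSr; set s := (- (T * v)) ^+ k in IHk *.
  have -> : z - s * - (T * v) * z = (z - s * z) + s * ((1 + T * v) * z).
    by ring.
  by apply: dvdUD => //; apply: dvdUM.
rewrite -(subrK ((- (T * v)) ^+ m * z) z); apply: dvdUD => //.
by rewrite -mulrN exprMn -mulrA mulrC; apply: dvdUM.
Qed.

Section Annihilator.
Variables (f : nat -> Zp_int p) (x : R) (m l : nat) (f' : nat -> Zp_int p).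
Hypothesis fx : is_power_series_value gamma f x.
Hypothesis f'E : forall i, f i = f' i *+ p ^ m.
Hypothesis f'_low : forall i, (i < l)%N -> dvdp 1 (f' i).
Hypothesis f'_l : ~ dvdp 1 (f' l).

(** Once [p ^ m] is divided out, the terms below [l] vanish modulo [p] and the coefficient of
    [T ^+ l] is invertible modulo [p]. Up to it, the series is [T ^+ l] times a factor [1 + T * v],
    which [dvdU_unit_factor] removes. *)
Lemma dvdU_T_l n y : x * y = 0 -> dvdU (Un n) (T ^+ l * y).
Proof.
(* Precision [m.+1] leaves one factor [p] after division by [p ^ m]; below, [N] also exceeds [l], so
   that the term of index [l] occurs. *)
move=> xy0; have [N0 xN] := fx (Un n) m.+1.
set U := Un n in xN *; pose N := (N0 + l.+1)%N.
pose w (i : nat) : R := cgr_scalar (f' i) * T ^+ i.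
have dw : dvdU U ((\sum_(0 <= i < N) w i) * y).
  move=> g; apply: (@mulrn_pX_dvdp p p_prime m).
  have := congr1 (fun z => cgr_coef z U g) xy0; rewrite !cgr_coefM => xy.
  rewrite -[_ *+ _]subr0 -[X in _ - X]xy -sumrMnl -sumrB; apply: dvdp_sum => h _.
  rewrite -mulrnAl -mulrBl mulrC; apply: dvdpM.
  have [b bE] := xN N (leq_addr _ _) h; exists (- b); rewrite mulNrn -bE opprB; congr (_ - _).
  rewrite cgr_coef_sum big_mkord -sumrMnl; apply: eq_bigr => i _.
  by rewrite /w cgr_scalarE f'E mulrnAl.
have [c [d cd]] := inverse_mod_p p_prime f'_l.
pose v : R := \sum_(l.+1 <= i < N) cgr_scalar (f' i) * T ^+ (i - l.+1).
apply: (@dvdU_unit_factor _ (cgr_scalar c * v) _ (p ^ n)); first exact: dvdU_T_exp.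
have wE : \sum_(0 <= i < N) w i =
    \sum_(0 <= i < l) w i + (cgr_scalar (f' l) * T ^+ l + T ^+ l.+1 * v).
  have lN : (l < N)%N by rewrite /N addnS ltnS leq_addl.
  rewrite (big_cat_nat (leq0n l) (ltnW lN)) /= (big_ltn lN).
  congr (_ + (_ + _)); rewrite /v mulr_sumr; apply: eq_big_nat => i /andP[li _].
  by rewrite /w mulrCA -exprD subnKC.
have cfl : cgr_scalar c * cgr_scalar (f' l) = 1 + cgr_scalar d *+ p.
  apply: cgr_eq => V g; rewrite cgr_scalarE cgr_coefD cgr_coefMn /= mulrA cd.
  by rewrite mulrDl mul1r mulrnAl.
have -> : (1 + T * (cgr_scalar c * v)) * (T ^+ l * y) =
    cgr_scalar c * ((\sum_(0 <= i < N) w i) * y)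
    - cgr_scalar c * ((\sum_(0 <= i < l) w i) * y) - (cgr_scalar d * (T ^+ l * y)) *+ p.
  rewrite wE; move: cfl; set sc := cgr_scalar c; set sl := cgr_scalar (f' l) => cfl.
  have -> : sc * ((\sum_(0 <= i < l) w i + (sl * T ^+ l + T ^+ l.+1 * v)) * y) =
    sc * ((\sum_(0 <= i < l) w i) * y) + (sc * sl) * (T ^+ l * y) + sc * v * (T ^+ l.+1 * y).
    by ring.
  rewrite cfl exprS -[_ *+ p]mulr_natr -[in RHS](mulr_natr _ p); ring.
apply: dvdUD; last by apply: dvdUN; apply: dvdUMp.
apply: dvdUD; first exact: dvdUM.
apply/dvdUN/dvdUM; rewrite mulr_suml big_nat; apply: dvdU_sum => i /andP[_ il] g.
rewrite /w -mulrA cgr_scalarE mulrC; apply: dvdpM; exact: f'_low.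
Qed.

Lemma T_exp_periodic n k y g : dvdU (Un n) (T ^+ (p ^ k) * y) ->
  dvdp 1 (cgr_coef y (Un n) (g - gamma *+ p ^ k) - cgr_coef y (Un n) g).
Proof.
have [z ->] := T_exp k => /(_ g); rewrite mulrDl mulrBl mul1r cgr_coefD => d.
rewrite -[X in dvdp 1 X]addr0 -(subrr (cgr_coef (z *+ p * y) (Un n) g)) addrA.
apply: dvdpD; first by move: d; rewrite cgr_coefD cgr_coefN group_element_mulE.
have : dvdU (Un n) (- (z *+ p * y)) by apply: dvdUN; rewrite mulrC; apply: dvdUM; apply: dvdUMp.
exact.
Qed.

End Annihilator.

Hypothesis u_inj : injective u.

(** The quotient of [Un k] by [Un k.+1] is cyclic of order [p], generated by the class of
    [gamma *+ p ^ k]. *)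
Lemma coef_level_sum k y g :
  cgr_coef y (Un k) g = \sum_(0 <= j < p) cgr_coef y (Un k.+1) (g + gamma *+ (j * p ^ k)).
Proof.
set U := Un k.+1; pose r (j : nat) := coset_repr U (g + gamma *+ (j * p ^ k)).
have sU := osub_subgroup U; have fU := osub_fin U; have sUk := osub_subgroup (Un k).
have UUk : U `<=` Un k by apply: Un_decreasing.
have gE j : gamma *+ (j * p ^ k) = u (j%:R *+ p ^ k) by rewrite -mulrnA uMn.
have rP j : osub U (g + gamma *+ (j * p ^ k) - r j) by apply: coset_reprP.
rewrite (cgr_compat y UUk).
transitivity (\sum_(h <- [seq r j | j <- index_iota 0 p]) cgr_coef y U h); last first.
  rewrite big_map; apply: eq_bigr => j _; have /(subNg sU) rj := rP j.
  by rewrite -(cgr_periodic y (g + gamma *+ (j * p ^ k)) rj) opprB addrC subrK.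
rewrite -big_filter; apply/perm_big/uniq_perm.
- by rewrite filter_uniq // uniq_transversal.
- rewrite map_inj_in_uniq ?iota_uniq // => i j; rewrite !mem_index_iota => /= ip jp rij.
  have : osub U (gamma *+ (i * p ^ k) - gamma *+ (j * p ^ k)).
    have := subBg sU (rP i) (rP j); rewrite rij opprB addrA subrK.
    by rewrite opprD addrACA subrr add0r.
  rewrite !gE -uN -uD => /UnE[a /u_inj E].
  apply: (@natr_Zp_inj_mod p p_prime i j a) => //; apply: (@mulrn_pX_inj p p_prime k).
  by rewrite mulrnDl -[a *+ p *+ _]mulrnA -expnS -E addrC subrK.
- move=> h; rewrite mem_filter mem_transversal //; apply/andP/mapP => [[/asboolP gh /eqP hh]|[j _ ->]].
    have /UnE[a aE] := subBC sUk gh.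
    have [j [b [jp ab]]] := p_decomp p_prime a.
    exists j; first by rewrite mem_index_iota.
    rewrite -hh; apply: coset_repr_eq => //; rewrite opprD addrA aE ab mulrnDl uD gE addrAC subrr add0r.
    by apply/UnE; exists b; rewrite -[b *+ p *+ _]mulrnA -expnS.
  split; last by rewrite coset_repr_id.
  apply/asboolP; have -> : g - r j = g + gamma *+ (j * p ^ k) - r j - gamma *+ (j * p ^ k).
    by rewrite addrAC addrK.
  by apply: (subBg sUk); [exact: UUk | rewrite gE; apply/UnE; exists j%:R].
Qed.

Lemma power_series_value_regular (f : nat -> Zp_int p) (x : R) :
  (exists i, f i != 0) -> is_power_series_value gamma f x -> GRing.lreg x.
Proof.
move=> fn0 fx; have [m [f' [l [f'E f'_low f'_l]]]] := Zp_series_p_part fn0.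
have step y : x * y = 0 -> exists2 z, x * z = 0 & y = z *+ p.
  move=> xy.
  have dT n k : (l <= k)%N -> dvdU (Un n) (T ^+ (p ^ k) * y).
    move=> lk; have lpk : (l <= p ^ k)%N.
      by rewrite (leq_trans lk) // ltnW // ltn_expl // prime_gt1.
    rewrite -(subnK lpk) exprD -mulrA; apply: dvdUM.
    exact: (dvdU_T_l fx f'E f'_low f'_l).
  have dk k : (l <= k)%N -> dvdU (Un k) y.
    move=> lk g; rewrite coef_level_sum.
    have per j : dvdp 1 (cgr_coef y (Un k.+1) (g + gamma *+ (j * p ^ k)) - cgr_coef y (Un k.+1) g).
      elim: j => [|j IHj]; first by rewrite mul0n mulr0n addr0 subrr; apply: dvdp0.
      (* Level [k.+1] is combined with the period [gamma *+ p ^ k], the step between the translates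
         summed by [coef_level_sum]. *)
      have := T_exp_periodic (g + gamma *+ (j.+1 * p ^ k)) (dT k.+1 k lk).
      rewrite mulSn addnC mulrnDr addrA addrK => -[b bE].
      have -> : cgr_coef y (Un k.+1) (g + gamma *+ (j * p ^ k) + gamma *+ p ^ k) =
         cgr_coef y (Un k.+1) (g + gamma *+ (j * p ^ k)) - b *+ p ^ 1 by rewrite -bE subKr.
      by rewrite addrAC -mulNrn; apply: dvdpD => //; exists (- b).
    rewrite -(subrK (\sum_(0 <= j < p) cgr_coef y (Un k.+1) g) (\sum_(0 <= j < p) _)).
    apply: dvdpD; first by rewrite -sumrB; apply: dvdp_sum => j _; apply: per.
    by rewrite sumr_const_nat subn0; exists (cgr_coef y (Un k.+1) g); rewrite expn1.
  have dU U : dvdU U y.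
    move=> g; have [n UnU] := Un_small U.
    have UnU' : Un (maxn n l) `<=` U by move=> h /(Un_decreasing (leq_maxl n l))/UnU.
    by rewrite (cgr_compat y UnU'); apply: dvdp_sum => h _; apply: dk; apply: leq_maxr.
  (* The quotient of [y] by [p] is built coefficient by coefficient; it inherits periodicity and
     compatibility because multiplication by [p] is injective on [Z_p]. *)
  pose z U g := projT1 (cid (dU U g)).
  have zE U g : cgr_coef y U g = z U g *+ p := projT2 (cid (dU U g)).
  have pinj (a b : Zp_int p) : a *+ p = b *+ p -> a = b by apply: (@mulrn_pX_inj p p_prime 1).
  have zper (U : open_subgroup F act) g h : osub U h -> z U (g + h) = z U g.
    by move=> Uh; apply: pinj; rewrite -!zE cgr_periodic.
  have zcompat (U V : open_subgroup F act) : U `<=` V -> forall g,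
      z V g = \sum_(h <- transversal U | `[< osub V (g - h) >]) z U h.
    move=> UV g; apply: pinj; rewrite -zE (cgr_compat y UV) -sumrMnl.
    by apply: eq_bigr => h _; rewrite zE.
  exists (CompletedGroupRing zper zcompat); last by apply: cgr_eq => U g; rewrite cgr_coefMn zE.
  have xz : (x * CompletedGroupRing zper zcompat) *+ p = 0.
    by rewrite -mulrnAr -xy; congr (_ * _); apply: cgr_eq => U g; rewrite cgr_coefMn zE.
  apply: cgr_eq => U g; apply: (@mulrn_p_inj p p_prime); rewrite -cgr_coefMn.
  by rewrite xz.
have x0 y : x * y = 0 -> y = 0.
  move=> xy; apply: cgr_eq => U g; apply: (dvdp_all_eq0 p_prime) => k.
  elim: k y xy => [|k IHk] y xy; first by exists (cgr_coef y U g).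
  have [z xz ->] := step y xy; have [b bE] := IHk z xz.
  by exists b; rewrite cgr_coefMn bE -mulrnA -expnSr.
move=> y z E; apply/eqP; rewrite -subr_eq0; apply/eqP/x0.
by rewrite mulrBr E subrr.
Qed.

End PowerSeriesValues.
(** * Open subgroups of Gal(L/K') *)

Section GaloisSubgroups.
Implicit Types (F K L : set algC) (x y : algC).

Section Subfield.
Variable F : set algC.
Hypothesis F_field : is_subfield F.

Lemma subfield1 : F 1. Proof. by case: F_field. Qed.
Lemma subfieldB x y : F x -> F y -> F (x - y). Proof. by case: F_field => _ [H _]; apply: H. Qed.
Lemma subfield_div x y : F x -> F y -> F (x / y).
Proof. by case: F_field => _ [_ H]; apply: H. Qed.
Lemma subfield0 : F 0.
Proof. by rewrite -(subrr 1); apply: subfieldB; apply: subfield1. Qed.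
Lemma subfieldN x : F x -> F (- x).
Proof. by move=> Fx; rewrite -sub0r; apply: subfieldB => //; apply: subfield0. Qed.
Lemma subfieldD x y : F x -> F y -> F (x + y).
Proof. by move=> Fx Fy; rewrite -(opprK y); apply: subfieldB => //; apply: subfieldN. Qed.
Lemma subfieldM x y : F x -> F y -> F (x * y).
Proof.
move=> Fx Fy; rewrite -(invrK y) -(mul1r y^-1); apply: subfield_div => //.
by apply: subfield_div => //; apply: subfield1.
Qed.
Lemma subfieldX x n : F x -> F (x ^+ n).
Proof.
by move=> Fx; elim: n => [|n IHn]; [apply: subfield1 | rewrite exprS; apply: subfieldM].
Qed.
Lemma subfield_nat n : F n%:R.
Proof.
by elim: n => [|n IHn]; [apply: subfield0 | rewrite mulrS; apply: subfieldD => //; apply: subfield1].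
Qed.
Lemma subfield_int (n : int) : F n%:~R.
Proof. by case: n => n; rewrite ?NegzE ?mulrNz; [|apply: subfieldN]; apply: subfield_nat. Qed.
Lemma subfield_rat (q : rat) : F (ratr q).
Proof. by apply: subfield_div; apply: subfield_int. Qed.
End Subfield.

Lemma generated_field_subfield (S : set algC) : is_subfield (generated_field S).
Proof.
split=> [E [E1 _] _ //|]; split=> x y Sx Sy E fE SE.
  by case: (fE) => _ [EB _]; apply: EB; [apply: Sx | apply: Sy].
by case: (fE) => _ [_ ED]; apply: ED; [apply: Sx | apply: Sy].
Qed.

Lemma sub_generated_field (S : set algC) : S `<=` generated_field S.
Proof. by move=> x Sx E _ /(_ x Sx). Qed.

Section Embedding.
Variables (L : set algC) (sigma : algC -> algC).
Hypotheses (L_field : is_subfield L) (sigma_emb : is_embedding L sigma).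

Lemma emb1 : sigma 1 = 1. Proof. by case: sigma_emb. Qed.
Lemma embD x y : L x -> L y -> sigma (x + y) = sigma x + sigma y.
Proof. by case: sigma_emb => _ [H _]; apply: H. Qed.
Lemma embM x y : L x -> L y -> sigma (x * y) = sigma x * sigma y.
Proof. by case: sigma_emb => _ [_ H]; apply: H. Qed.
Lemma emb0 : sigma 0 = 0.
Proof.
have L0 := subfield0 L_field.
by apply: (addrI (sigma 0)); rewrite -embD // !addr0.
Qed.
Lemma emb_sum (I : Type) (r : seq I) (P : pred I) (E : I -> algC) :
  (forall i, P i -> L (E i)) -> L (\sum_(i <- r | P i) E i) /\
  sigma (\sum_(i <- r | P i) E i) = \sum_(i <- r | P i) sigma (E i).
Proof.
move=> LE; elim/big_rec2: _ => [|i y1 y2 Pi [Ly <-]].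
  by split; [apply: subfield0 | apply: emb0].
by split; [apply: subfieldD => //; apply: LE | rewrite embD //; apply: LE].
Qed.
Lemma embX x n : L x -> sigma (x ^+ n) = sigma x ^+ n.
Proof.
move=> Lx; elim: n => [|n IHn]; first exact: emb1.
by rewrite !exprS embM ?IHn //; apply: subfieldX.
Qed.
End Embedding.

Section Automorphisms.
Variables (K L : set algC).
Hypotheses (K_field : is_subfield K) (L_field : is_subfield L) (KL : K `<=` L).

Lemma automorphism_root sigma (q : {poly rat}) x : is_automorphism K L sigma -> L x ->
  root (map_poly ratr q) x -> root (map_poly ratr q) (sigma x).
Proof.
move=> [emb [fixK _]] Lx; have Kq i : K (map_poly ratr q)`_i.
  by rewrite coef_map; apply: subfield_rat.
rewrite /root !horner_coef => /eqP E; apply/eqP.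
have LE (i : 'I_(size (map_poly (ratr : rat -> algC) q))) : L ((map_poly ratr q)`_i * x ^+ i).
  by apply: (subfieldM L_field); [apply/KL/Kq | apply: subfieldX].
have [_] := emb_sum L_field emb (index_enum _) (P := xpredT) (fun i _ => LE i).
rewrite E (emb0 L_field emb) => {}E; rewrite [RHS]E; apply: eq_bigr => i _.
have Lq : L (map_poly ratr q)`_i by apply/KL/Kq.
have LX : L (x ^+ i) by apply: subfieldX.
by rewrite (embM emb Lq LX) (fixK _ (Kq i)) (embX L_field emb).
Qed.

(* sigma x is one of the finitely many conjugates of x over the rationals. *)
Lemma automorphism_finite_orbit x : L x ->
  exists r : seq algC, forall sigma, is_automorphism K L sigma -> sigma x \in r.
Proof.
move=> Lx; have [q [qE q_monic _]] := minCpolyP x.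
have [r rE] := closed_field_poly_normal (minCpoly x); exists r => sigma aut.
have : root (minCpoly x) (sigma x).
  by rewrite qE; apply: automorphism_root => //; rewrite -qE root_minCpoly.
by rewrite rE (monicP (minCpoly_monic x)) scale1r root_prod_XsubC.
Qed.

Variables (G : zmodType) (act : G -> algC -> algC).
Hypothesis G_Galois : is_Galois_group K L act.

Lemma act_automorphism g : is_automorphism K L (act g). Proof. by case: G_Galois. Qed.
Lemma act_emb g : is_embedding L (act g). Proof. by case: (act_automorphism g). Qed.
Lemma actD g h x : L x -> act (g + h) x = act g (act h x).
Proof. by case: G_Galois => _ [H _]; apply: H. Qed.
Lemma act_fix g x : K x -> act g x = x.
Proof. by case: (act_automorphism g) => _ [H _]; apply: H. Qed.
Lemma act0 x : L x -> act 0 x = x.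
Proof.
move=> Lx; have [_ [_ im]] := act_automorphism 0.
have [y Ly <-] : (act 0 @` L) x by rewrite im.
by rewrite -actD // addr0.
Qed.

Variable K' : set algC.
Hypotheses (K'L : K' `<=` L) (K'_finite : finite_extension K K').

Lemma act_sub_fixing (s : seq algC) g h :
  (forall x, x \in s -> K' x) ->
  (forall x, K' x -> exists c : 'I_(size s) -> algC, (forall i, K (c i)) /\ x = \sum_i c i * s`_i) ->
  (forall x, x \in s -> act g x = act h x) -> fixing act K' (g - h).
Proof.
move=> sK' span gh x K'x; have Lx := K'L K'x.
have E : act g x = act h x.
  have [c [Kc ->]] := span x K'x.
  have LE (i : 'I_(size s)) : L (c i * s`_i).
    by apply: (subfieldM L_field); [apply/KL/Kc | apply/K'L/sK'/mem_nth].
  have [_ ->] := emb_sum L_field (act_emb g) (index_enum _) (P := xpredT) (fun i _ => LE i).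
  have [_ ->] := emb_sum L_field (act_emb h) (index_enum _) (P := xpredT) (fun i _ => LE i).
  apply: eq_bigr => i _; have Lc : L (c i) by apply: KL.
  have Ls : L s`_i by apply/K'L/sK'/mem_nth.
  by rewrite (embM (act_emb g)) // (embM (act_emb h)) // (act_fix g (Kc i)) (act_fix h (Kc i)) gh ?mem_nth.
by rewrite addrC actD // E -actD // addNr act0.
Qed.

(** A class modulo this subgroup is determined by the images of a finite family spanning [K'] over
    [K], and each image has finitely many possible values. *)
Lemma fixing_finite_index : finite_index (fixing act K').
Proof.
have [_ [s [sK' span]]] := K'_finite.
have ex (i : 'I_(size s)) : exists r : seq algC, forall g, act g s`_i \in r.
  have [|r rP] := @automorphism_finite_orbit s`_i; first by apply/K'L/sK'/mem_nth.
  by exists r => g; apply/rP/act_automorphism.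
pose r := flatten [seq projT1 (cid (ex i)) | i <- enum 'I_(size s)].
have rP g (i : 'I_(size s)) : act g s`_i \in r.
  apply/flattenP; exists (projT1 (cid (ex i))); last exact: (projT2 (cid (ex i))).
  by apply: (map_f (fun i => projT1 (cid (ex i)))); rewrite mem_enum.
pose T : finType := {ffun 'I_(size s) -> seq_sub r}.
(* The default 0 is harmless: below, [t] is the tuple of images under an actual [g]. *)
pose rep (t : T) := xget 0 [set h | forall i : 'I_(size s), act h s`_i = val (t i)].
exists [seq rep t | t <- enum T] => g.
pose t : T := [ffun i => SeqSub (rP g i)].
exists (rep t); first by apply: map_f; rewrite mem_enum.
apply: (act_sub_fixing sK' span) => x /(nthP 0)[i lti <-].
rewrite /rep; case: xgetP => [h -> /= /(_ (Ordinal lti)) ->|]; first by rewrite ffunE.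
by move=> /(_ g); case=> j; rewrite ffunE.
Qed.

Variables (p : nat) (u : Zp_int p -> G).
Hypothesis p_prime : prime p.
Hypothesis u_iso : Zp_isomorphism L act (fixing act K') u.

(** The image of [p^n Z_p] has index at most [p ^ n] in [fixing act K'], itself of finite index in
    [G]. *)
Lemma Zp_level_subgroups : exists Un : nat -> open_subgroup L act,
  forall n g, osub (Un n) g <-> exists a, g = u (a *+ p ^ n).
Proof.
have [uD [u_inj [u_range [_ u_open]]]] := u_iso.
suff ex n : exists U : open_subgroup L act, forall g, osub U g <-> exists a, g = u (a *+ p ^ n).
  by exists (fun n => projT1 (cid (ex n))) => n; apply: (projT2 (cid (ex n))).
pose V : set G := [set g | exists a, g = u (a *+ p ^ n)].
have sV : is_subgroup V.
  split=> [|_ _ [a ->] [b ->]]; first by exists 0; rewrite mul0rn (u0 uD).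
  by exists (a - b); rewrite mulrnBl uD (uN uD).
have oV : Krull_open L act V.
  split=> //; have [U [_ [s [sL sU]]] UP] := u_open n; have [_ [s' [s'K' span]]] := K'_finite.
  (* Fixing [s'] puts [g] in the range of [u], fixing [s] puts it in [U]; together they put it in
     [V]. *)
  exists (s ++ s'); split=> [x|g gs].
    by rewrite mem_cat => /orP[/sL //|/s'K'/K'L].
  have Ug : U g by apply: sU => x xs; apply: gs => /=; rewrite mem_cat xs.
  have : fixing act K' (g - 0).
    apply: (act_sub_fixing s'K' span) => x xs; rewrite act0; last exact/K'L/s'K'.
    by apply: gs => /=; rewrite mem_cat xs orbT.
  rewrite subr0 -u_range => -[a _ ga]; move: Ug; rewrite -ga => /UP[b ->].
  by exists b.
have fV : finite_index V.
  have [s sP] := fixing_finite_index.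
  exists [seq h + u (j : nat)%:R | h <- s, j <- iota 0 (p ^ n)] => g.
  have [h hs] := sP g; rewrite -u_range => -[a _ ga].
  have [j [b [jp ab]]] := Zp_decomp p_prime n a.
  exists (h + u j%:R); first by apply/allpairsP; exists (h, j); rewrite mem_iota.
  by exists b; rewrite opprD addrA -ga ab uD addrAC subrr add0r.
by exists (OpenSubgroup oV fV).
Qed.

End Automorphisms.
End GaloisSubgroups.

(** * From torsion over [Z_p[[T]]] to the independence of the sequence *)

(** The product of annihilators of finitely many generators is regular and kills the module. *)
Lemma is_torsion_killed (p : nat) (F : set algC) (G : zmodType) (act : G -> algC -> algC)
    (gamma : G) (M : lmodType (completed_group_ring p F act)) :
  (forall f (x : completed_group_ring p F act), (exists i, f i != 0) ->
     is_power_series_value gamma f x -> GRing.lreg x) ->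
  finitely_generated M -> is_torsion gamma M -> fg_killed M.
Proof.
move=> reg fgM torM; split=> //; have [a [v span]] := fgM.
have ex i : exists x, GRing.lreg x /\ x *: v i = 0.
  by have [f [x [f0 [fx xv]]]] := torM (v i); exists x; split; first exact: reg fx.
pose x i := projT1 (cid (ex i)).
have xP i : GRing.lreg (x i) /\ x i *: v i = 0 := projT2 (cid (ex i)).
exists (\prod_i x i).
  elim/big_ind: _ => [|y z regy regz|i _]; first exact: lreg1; last by case: (xP i).
  exact: lregM.
move=> w; have [c ->] := span w; rewrite scaler_sumr big1 // => i _.
rewrite (bigD1 i) //= scalerA -mulrA mulrC -scalerA.
by case: (xP i) => _ ->; rewrite !scaler0.
Qed.

Theorem theorem1p2
  (p : nat) (p_prime : prime p) (p_odd : odd p)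
  (* the fields *)
  (K Kcyc K' L : set algC)
  (K_number_field : is_number_field K) (K_real : is_totally_real K)
  (Kcyc_cyclotomic : is_cyclotomic_Zp_extension p K Kcyc)
  (K'_number_field : is_number_field K') (K'_real : is_totally_real K')
  (K'_abelian : is_abelian_p_extension p K K')
  (K'_Kcyc : K' `&` Kcyc = K)
  (L_compositum : L = compositum K' Kcyc)
  (* G = Gal(L/K), and gamma is a topological generator of Gal(L/K') ~ Z_p *)
  (G : zmodType) (act : G -> algC -> algC)
  (G_Galois : is_Galois_group K L act)
  (gamma : G) (gamma_generator : is_Zp_generator p L act (fixing act K') gamma)
  (* Q is the total ring of fractions of R = Z_p[[G]] *)
  (Q : comUnitRingType) (iota : {rmorphism completed_group_ring p L act -> Q})
  (Q_fractions : is_total_fraction_ring iota)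
  (M : lmodType (completed_group_ring p L act))
  (M_fg : finitely_generated M) (M_torsion : is_torsion gamma M)
  (n : nat)
  (* two sequences 0 -> X_0 -> X_1 -> ... -> X_n -> M -> 0 *)
  (X Y : exact_sequence M n)
  (X_fg : forall i, (i <= n)%N -> finitely_generated (X i))
  (X_torsion : forall i, (i <= n)%N -> is_torsion gamma (X i))
  (X_pd : forall i, (1 <= i <= n)%N -> pd_le 1 (X i))
  (Y_fg : forall i, (i <= n)%N -> finitely_generated (Y i))
  (Y_torsion : forall i, (i <= n)%N -> is_torsion gamma (Y i))
  (Y_pd : forall i, (1 <= i <= n)%N -> pd_le 1 (Y i)) :
  shifted_Fitt iota X = shifted_Fitt iota Y.
Proof.
have [K_field _] := K_number_field; have [KK' _] := K'_abelian.1.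
have K'L : K' `<=` L.
  by rewrite L_compositum => x K'x; apply: sub_generated_field; left.
have L_field : is_subfield L by rewrite L_compositum; apply: generated_field_subfield.
have KL : K `<=` L by apply: subset_trans K'L.
have [u [u_iso u1]] := gamma_generator; have [uD [u_inj [_ [u_small _]]]] := u_iso.
have [Un UnE] := Zp_level_subgroups K_field L_field KL G_Galois K'L K'_abelian.1 p_prime u_iso.
(* Continuity of [u] makes the levels cofinal among the open subgroups of [G]. *)
have Un_small (U : open_subgroup L act) : exists n, Un n `<=` U.
  by have [k kU] := u_small U (osub_open U); exists k => g /UnE[a ->].
have reg f (x : completed_group_ring p L act) : (exists i, f i != 0) -> is_power_series_value gamma f x -> GRing.lreg x.
  by rewrite -u1; apply: (power_series_value_regular p_prime p_odd uD UnE Un_small u_inj).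
apply: (shifted_Fitt_value_unique Q_fractions (n := n) (M := M)).
  by apply: shifted_Fitt_valueP => // i lei; apply: (is_torsion_killed reg); auto.
by apply: shifted_Fitt_valueP => // i lei; apply: (is_torsion_killed reg); auto.
Qed.
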